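(* Let $M=(M_k)$ be a weight sequence and let $C^{[M]}$ denote either $C^{(M)}$ or $C^{\{M\}}$. Let $E,F,G$ be convenient vector spaces and let $U\subseteq F$ be $c^\infty$-open. A linear mapping $T:E\to C^{[M]}(U,G)$ is bounded (i.e. maps bounded sets to bounded sets) if and only if $\operatorname{ev}_x\circ T:E\to G$ is bounded for every $x\in U$, where $\operatorname{ev}_x(f)=f(x)$.
   Context: $\mathbb N=\{0,1,2,\dots\}$. A weight sequence $M=(M_k)_{k\in\mathbb N}$ is a sequence of positive reals with $M_0=1\le M_1$. $C^{[M]}$ stands, within one statement, either everywhere for $C^{(M)}$ or everywhere for $C^{\{M\}}$. Jets on Banach spaces. For Banach spaces $E,F$ let $L^k_{\rm sym}(E,F)$ be the Banach space of bounded symmetric $k$-linear maps $E^k\to F$ with the operator norm. For compact $K\subseteq E$ and $f=(f^k)_k\in\prod_k C(K,L^k_{\rm sym}(E,F))$ put $\|f\|_k=\sup_{x\in K}\|f^k(x)\|$, $(R^n_yf)^k(x)=f^k(x)-\sum_{j=0}^n\frac1{j!}f^{j+k}(y)(x-y,\dots,x-y,\cdot)$, $|||f|||_{n,k}=\sup\{(n+1)!\,\|(R^n_yf)^k(x)\|/\|x-y\|^{n+1}:x\ne y\in K\}$, and $$\|f\|_\rho=\max\Big\{\sup_m\frac{\|f\|_m}{m!\rho^mM_m},\ \sup_{n,k}\frac{|||f|||_{n,k}}{(n+k+1)!\rho^{n+k+1}M_{n+k+1}}\Big\}.$$ $C^M_\rho(E\supseteq K,F)$ is the space of those $f$ with $\|f\|_\rho<\infty$,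 normed by $\|\cdot\|_\rho$. For compact convex $K$ put $C^{(M)}(E\supseteq K,F)=\varprojlim_{\rho>0}C^M_\rho(E\supseteq K,F)$ and $C^{\{M\}}(E\supseteq K,F)=\varinjlim_{\rho>0}C^M_\rho(E\supseteq K,F)$ (locally convex limits). For open $U\subseteq E$, $C^{[M]}(U,F)$ is the space of all $C^\infty$ (Fréchet) maps $f:U\to F$ with $j^\infty f|_K=(f^{(k)}|_K)_k\in C^{[M]}(E\supseteq K,F)$ for all compact convex $K\subseteq U$, with the initial locally convex topology induced by the maps $f\mapsto j^\infty f|_K$. Convenient vector spaces. A convenient vector space is a real Hausdorff locally convex space that is Mackey complete. Its $c^\infty$-topology is the final topology with respect to all $C^\infty$-curves $\mathbb R\to E$. A mapping on a $c^\infty$-open set is $C^\infty$ if it maps $C^\infty$-curves to $C^\infty$-curves. $F^*$ is the space of continuous linear functionals. For closed absolutely convex bounded $B\subseteq E$, $E_B$ is the span of $B$ with the Minkowski functional of $B$ as norm (a Banach space), $i_B:E_B\to E$ the inclusion, $U_B=U\cap E_B$. For $c^\infty$-open $U\subseteq E$, $$C^{[M]}(U,F)=\{f\in C^\infty(U,F):\ell\circ f\circ i_B\in C^{[M]}(U_B,\mathbb R)\ \forall\ell\in F^*,\forall B\},$$ with the initial locally convex structure induced by all maps $f\mapsto\ell\circ f\circ i_B\in C^{[M]}(U_B,\mathbb R)$; this is a convenient vector space. *)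

(* Defs.v *)
From HB Require Import structures.
From mathcomp Require Import all_boot all_order all_algebra all_fingroup.
From mathcomp Require Import all_classical all_reals all_analysis.

Set Implicit Arguments.
Unset Strict Implicit.
Unset Printing Implicit Defensive.

Import Order.TTheory GRing.Theory Num.Theory.
Import numFieldNormedType.Exports.

Local Open Scope classical_set_scope.
Local Open Scope ring_scope.

Definition upd (T : Type) k (v : 'I_k -> T) (i : 'I_k) (x : T) : 'I_k -> T :=
  fun j => if j == i then x else v j.

(* The argument tuple (h, ..., h, v_0, ..., v_(k-1)) with h repeated j times. *)
Definition padl (T : Type) j k (h : T) (v : 'I_k -> T) : 'I_(j + k) -> T :=
  fun i => match fintype.split i with inl _ => h | inr i' => v i' end.
Arguments padl {T} j {k} h v _.

Section lsym.
Context {R : realType} {E F : normedModType R} {k : nat}.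
Implicit Types L : ('I_k -> E) -> F.

Definition multilinear L := forall (v : 'I_k -> E) i a x y,
  L (upd v i (a *: x + y)) = a *: L (upd v i x) + L (upd v i y).

Definition symmetric_map L :=
  forall (s : {perm 'I_k}) v, L (fun i => v (s i)) = L v.

Definition bounded_multi L :=
  exists C : R, forall v, `|L v| <= C * \prod_i `|v i|.

Definition lsym_pred : {pred ('I_k -> E) -> F} := fun L =>
  `[< [/\ multilinear L, symmetric_map L & bounded_multi L] >].

Definition opnorm L : R :=
  sup [set `|L v| | v in [set v | forall i, `|v i| <= 1]].

Lemma lsym_submod_closed : submod_closed lsym_pred.
Proof.
split=> [|a L1 L2].
  apply/asboolP; split=> [v i a x y|s v|] /=.
  - by rewrite /= scaler0 addr0.
  - by [].
  - by exists 0 => v; rewrite normr0 mul0r.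
move=> /asboolP[m1 s1 [C1 b1]] /asboolP[m2 s2 [C2 b2]]; apply/asboolP; split.
- move=> v i b x y; rewrite -![(_ + _) _]/(a *: L1 _ + L2 _).
  by rewrite m1 m2 !scalerDr !scalerA [a * b]mulrC addrACA.
- by move=> s v; rewrite -![(_ + _) _]/(a *: L1 _ + L2 _) s1 s2.
- exists (`|a| * C1 + C2) => v; rewrite -![(_ + _) _]/(a *: L1 _ + L2 _).
  rewrite (le_trans (ler_normD _ _))// mulrDl lerD// normrZ -mulrA.
  by rewrite ler_wpM2l.
Qed.

HB.instance Definition _ :=
  GRing.isSubmodClosed.Build R (('I_k -> E) -> F) lsym_pred lsym_submod_closed.

End lsym.

Record Lsym (R : realType) (k : nat) (E F : normedModType R) := MkLsym {
  lsym_fun :> ('I_k -> E) -> F ;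
  lsymP : lsym_fun \in lsym_pred }.

Section lsym_normed.
Context {R : realType} {k : nat} {E F : normedModType R}.
Local Notation L := (Lsym k E F).

HB.instance Definition _ := [isSub for @lsym_fun R k E F].
HB.instance Definition _ := [Choice of L by <:].
HB.instance Definition _ := [SubChoice_isSubLmodule of L by <:].

Lemma lsym_scale (l : L) (c : 'I_k -> R) (v : 'I_k -> E) :
  l (fun i => c i *: v i) = (\prod_i c i) *: l v.
Proof.
have /asboolP[ml _ _] := lsymP l.
have scale1 w i a x : l (upd w i (a *: x)) = a *: l (upd w i x).
  have l0 : l (upd w i 0) = 0.
    have := ml w i 1 0 0; rewrite scale1r scale1r addr0.
    by move/eqP; rewrite -subr_eq0 opprD addrA subrr sub0r oppr_eq0 => /eqP.
  by have := ml w i a x 0; rewrite l0 !addr0.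
have key s : uniq s -> l (fun i => if i \in s then c i *: v i else v i) =
    (\prod_(i <- s) c i) *: l v.
  elim: s => [_|i s IH /= /andP[ins us]].
    by rewrite big_nil scale1r.
  rewrite big_cons -scalerA -IH//.
  pose w j := if j \in s then c j *: v j else v j.
  have -> : (fun j => if j \in i :: s then c j *: v j else v j) =
            upd w i (c i *: v i).
    by apply/funext => j; rewrite /upd /w inE; case: eqVneq => [->|].
  rewrite scale1; congr (_ *: l _); apply/funext => j; rewrite /upd /w.
  by case: eqVneq => [->|//]; rewrite (negbTE ins).
rewrite -big_enum -key ?enum_uniq//; congr (l _).
by apply/funext => i; rewrite mem_enum.
Qed.

Lemma opnorm_has_sup (l : L) :
  has_sup [set `|l v| | v in [set v | forall i, `|v i| <= 1]].
Proof.
split; first by exists `|l (fun=> 0)|, (fun=> 0) => //= i; rewrite normr0.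
have /asboolP[_ _ [C bl]] := lsymP l.
exists `|C| => _ [v v1 <-]; rewrite (le_trans (bl v))//.
rewrite (le_trans (ler_norm _))// normrM -[leRHS]mulr1 ler_wpM2l//.
rewrite ger0_norm ?prodr_ge0//; apply: prodr_ile1 => i _.
by rewrite normr_ge0 v1.
Qed.

Lemma opnorm_ub (l : L) v : (forall i, `|v i| <= 1) -> `|l v| <= opnorm l.
Proof. by move=> v1; apply: ub_le_sup; [exact: (opnorm_has_sup l).2|exists v]. Qed.

Lemma opnorm_ge0 (l : L) : 0 <= opnorm l.
Proof.
by rewrite (le_trans (normr_ge0 (l (fun=> 0))))// opnorm_ub// => i; rewrite normr0.
Qed.

Lemma opnormP (l : L) v : `|l v| <= opnorm l * \prod_i `|v i|.
Proof.
have := @opnorm_ub l (fun i => `|v i|^-1 *: v i) => /= H.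
have -> : v = fun i => `|v i| *: (`|v i|^-1 *: v i).
  apply/funext => i; have [->|vi0] := eqVneq (v i) 0; first by rewrite !scaler0.
  by rewrite scalerA divff ?normr_eq0// scale1r.
rewrite (lsym_scale _ (fun i => `|v i|)) normrZ mulrC.
rewrite normr_prod.
have -> : \prod_i `| `|v i| | = \prod_i `| `|v i| *: (`|v i|^-1 *: v i)|.
  apply: eq_bigr => i _; have [->|vi0] := eqVneq (v i) 0.
    by rewrite !scaler0 !normr0.
  by rewrite scalerA divff ?normr_eq0// scale1r normr_id.
rewrite ler_wpM2r ?prodr_ge0// H// => i; rewrite normrZ normfV normr_id.
have [->|vi0] := eqVneq (v i) 0; first by rewrite normr0 mulr0.
by rewrite mulVf ?normr_eq0.
Qed.

Let ler_opnormD (l1 l2 : L) : opnorm (l1 + l2 : L) <= opnorm l1 + opnorm l2.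
Proof.
apply: sup_le_ub; first exact: (opnorm_has_sup (l1 + l2)).1.
by move=> _ [v v1 <-]; rewrite (le_trans (ler_normD _ _)) ?lerD ?opnorm_ub.
Qed.

Let opnormZ (a : R) (l : L) : opnorm (a *: l : L) = `|a| * opnorm l.
Proof.
have le b (m : L) : opnorm (b *: m : L) <= `|b| * opnorm m.
  apply: sup_le_ub; first exact: (opnorm_has_sup (b *: m)).1.
  move=> _ [v v1 <-]; rewrite -[(lsym_fun _) v]/(b *: m v) normrZ.
  by rewrite ler_wpM2l// opnorm_ub.
apply/eqP; rewrite eq_le le andTb; have [->|a0] := eqVneq a 0.
  by rewrite normr0 mul0r; exact: opnorm_ge0.
have := le a^-1 (a *: l); rewrite scalerA mulVf// scale1r normfV.
by rewrite ler_pdivlMl ?normr_gt0.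
Qed.

Let opnorm_eq0 (l : L) : opnorm l = 0 -> l = 0.
Proof.
move=> l0; apply/val_inj/funext => v /=; apply/eqP; rewrite -normr_le0.
by rewrite (le_trans (opnormP l v))// l0 mul0r.
Qed.

HB.instance Definition _ := @Lmodule_isNormed.Build R L
  (fun l : L => opnorm l) ler_opnormD opnormZ opnorm_eq0.

End lsym_normed.

Section lsym_plug.
Context {R : realType} {E F : normedModType R} (j k : nat).

Lemma lsym_plug_subproof (l : Lsym (j + k) E F) (h : E) :
  (fun v : 'I_k -> E => l (padl j h v)) \in lsym_pred.
Proof.
have /asboolP[ml sl _] := lsymP l; apply/asboolP; split.
- have H v i x : padl j h (upd v i x) = upd (padl j h v) (rshift j i) x.
    apply/funext => a; rewrite /padl /upd; case: (split_ordP a) => b ->.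
      by rewrite eq_lrshift.
    by rewrite (inj_eq (@rshift_inj _ _)).
  by move=> v i a x y; rewrite !H ml.
- move=> s v.
  pose g (a : 'I_(j + k)) := match fintype.split a with
    inl b => lshift k b | inr b => rshift j (s b) end.
  have injg : injective g.
    move=> a b; rewrite /g; case: (split_ordP a) => c ->; case: (split_ordP b) => d ->.
    - by move/lshift_inj ->.
    - by move/eqP; rewrite eq_lrshift.
    - by move/eqP; rewrite eq_rlshift.
    - by move/rshift_inj/perm_inj ->.
  rewrite -(sl (perm injg) (padl j h v)); congr (l _).
  apply/funext => a; rewrite permE /padl /g; case: (split_ordP a) => c _.
    by case: (split_ordP (lshift k c)) => d /eqP; rewrite ?eq_lrshift.
  case: (split_ordP (rshift j (s c))) => d /eqP; rewrite ?eq_rlshift//.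
  by rewrite eq_rshift => /eqP ->.
- exists (opnorm l * `|h| ^+ j) => v; rewrite (le_trans (opnormP _ _))//.
  rewrite big_split_ord/= -mulrA ler_wpM2l ?opnorm_ge0//.
  rewrite le_eqVlt; apply/orP; left; apply/eqP; congr (_ * _).
    under eq_bigr do rewrite /padl (unsplitK (inl _)).
    by rewrite prodr_const card_ord.
  by apply: eq_bigr => i _; rewrite /padl (unsplitK (inr _)).
Qed.

Definition lsym_plug (l : Lsym (j + k) E F) (h : E) : Lsym k E F :=
  MkLsym (lsym_plug_subproof l h).

End lsym_plug.
Arguments lsym_plug {R E F} j {k} l h.

Definition absconvex (R : realType) (V : lmodType R) (A : set V) :=
  A !=set0 /\ forall (a b : R) x y, `|a| + `|b| <= 1 -> A x -> A y ->
    A (a *: x + b *: y).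

(* A locally convex space whose underlying vector space is a subspace of V,
   given by this subspace and by its neighbourhoods of 0. Supersets in V of
   neighbourhoods of 0 are kept; only their trace on the carrier matters. *)
Record lcs (R : realType) (V : lmodType R) := Lcs {
  lcs_carrier : set V ;
  lcs_nbhs0 : set_system V }.

Definition lcs_of_tvs (R : realType) (V : tvsType R) : lcs V :=
  Lcs setT (nbhs (0 : V)).

Definition lcs_bounded (R : realType) (V : lmodType R) (X : lcs V)
    (A : set V) :=
  A `<=` lcs_carrier X /\ forall N, lcs_nbhs0 X N ->
    exists2 r : R, 0 < r & A `<=` [set r *: x | x in N].

Definition bounded_map (R : realType) (V W : lmodType R) (X : lcs V)
    (Y : lcs W) (f : V -> W) :=
  forall A, lcs_bounded X A -> lcs_bounded Y (f @` A).

(* p is meant to be a norm on the vectors of S at which it is finite. *)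
Definition lcs_normed (R : realType) (V : lmodType R) (S : set V)
    (p : V -> \bar R) : lcs V :=
  let X := [set v | S v /\ (p v < +oo)%E] in
  Lcs X [set N | exists2 e : R, 0 < e & X `&` [set v | (p v < e%:E)%E] `<=` N].

Definition lcs_initial (R : realType) (V : lmodType R) (S : set V)
    (I : Type) (D : set I) (W : I -> lmodType R) (f : forall i, V -> W i)
    (X : forall i, lcs (W i)) : lcs V :=
  Lcs [set v | S v /\ forall i, D i -> lcs_carrier (X i) (f i v)]
      (smallest Filter
        (\bigcup_(i in D) [set f i @^-1` N | N in lcs_nbhs0 (X i)])).

(* Projective and inductive limits of subspaces of V ordered by inclusion;
   the latter is given the finest locally convex topology making all the
   inclusions continuous. *)
Definition lcs_projlim (R : realType) (V : lmodType R) (I : Type) (D : set I)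
    (X : I -> lcs V) : lcs V :=
  lcs_initial setT D (fun _ => id) X.

Definition lcs_indlim (R : realType) (V : lmodType R) (I : Type) (D : set I)
    (X : I -> lcs V) : lcs V :=
  let Y := \bigcup_(i in D) lcs_carrier (X i) in
  Lcs Y [set N | exists A, [/\ absconvex A, A `<=` Y,
    (forall i, D i -> lcs_nbhs0 (X i) A) & A `<=` N]].

Definition jet (R : realType) (E F : normedModType R) (X : Type) :=
  forall k : nat, X -> Lsym k E F.

Section jet_lmod.
Context {R : realType} {E F : normedModType R} {X : Type}.
Local Notation J := (jet E F X).
Implicit Types f g h : J.

HB.instance Definition _ := gen_eqMixin J.
HB.instance Definition _ := gen_choiceMixin J.

Let j0 : J := fun _ _ => 0.
Let jadd f g : J := fun k x => f k x + g k x.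
Let jopp f : J := fun k x => - f k x.
Let jscale (a : R) f : J := fun k x => a *: f k x.

Let jext f g : (forall k x, f k x = g k x) -> f = g.
Proof. by move=> fg; apply: functional_extensionality_dep => k; apply/funext. Qed.

Let jaddA : associative jadd.
Proof. by move=> f g h; apply: jext => k x; exact: addrA. Qed.
Let jaddC : commutative jadd.
Proof. by move=> f g; apply: jext => k x; exact: addrC. Qed.
Let jadd0 : left_id j0 jadd.
Proof. by move=> f; apply: jext => k x; exact: add0r. Qed.
Let jaddN : left_inverse j0 jopp jadd.
Proof. by move=> f; apply: jext => k x; exact: addNr. Qed.

HB.instance Definition _ := GRing.isZmodule.Build J jaddA jaddC jadd0 jaddN.

Let jscaleA a b f : jscale a (jscale b f) = jscale (a * b) f.
Proof. by apply: jext => k x; exact: scalerA. Qed.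
Let jscale1 : left_id 1 jscale.
Proof. by move=> f; apply: jext => k x; exact: scale1r. Qed.
Let jscaleDr : right_distributive jscale +%R.
Proof. by move=> a f g; apply: jext => k x; exact: scalerDr. Qed.
Let jscaleDl f : {morph jscale^~ f : a b / a + b}.
Proof. by move=> a b; apply: jext => k x; exact: scalerDl. Qed.

HB.instance Definition _ :=
  GRing.Zmodule_isLmodule.Build R J jscaleA jscale1 jscaleDr jscaleDl.

End jet_lmod.

Variant flavour := Beurling | Roumieu.

Definition weight_sequence (R : realType) (M : nat -> R) :=
  [/\ forall k, 0 < M k, M 0%N = 1 & 1 <= M 1%N].

(* Supremum in [0, +oo], with value 0 on the empty set. *)
Definition sup0 (R : realType) (A : set \bar R) : \bar R :=
  ereal_sup (0%E |` A).

Section jet_spaces.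
Context {R : realType} {E F : normedModType R} (M : nat -> R).

Section norms.
Variable K : set E.
Implicit Types (f : jet E F K) (n k m : nat) (x y : K).

Definition jnorm f m : \bar R := sup0 [set (`|f m x|)%:E | x in [set: K]].

Definition jrem f n k y x : Lsym k E F :=
  f k x - \sum_(j < n.+1) (j`!%:R)^-1 *: lsym_plug j (f (j + k)%N y)
                                           (val x - val y).

Definition jremnorm f n k : \bar R :=
  sup0 [set (n.+1`!%:R * `|jrem f n k xy.2 xy.1|
              / `|val xy.1 - val xy.2| ^+ n.+1)%:E
       | xy in [set xy : K * K | xy.1 <> xy.2]].

Definition jnorm_rho (rho : R) f : \bar R :=
  maxe (sup0 [set (jnorm f m * ((m`!%:R * rho ^+ m * M m)^-1)%:E)%E
             | m in [set: nat]])
       (sup0 [set (jremnorm f nk.1 nk.2 *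
                   (((nk.1 + nk.2).+1`!%N%:R * rho ^+ (nk.1 + nk.2).+1%N
                     * M (nk.1 + nk.2).+1%N)^-1)%:E)%E
             | nk in [set: nat * nat]]).

Definition CM_rho (rho : R) : lcs (jet E F K) :=
  lcs_normed [set f : jet E F K | forall k, continuous (f k)] (jnorm_rho rho).

Definition CM_compact (b : flavour) : lcs (jet E F K) :=
  match b with
  | Beurling => lcs_projlim [set rho : R | 0 < rho] CM_rho
  | Roumieu => lcs_indlim [set rho : R | 0 < rho] CM_rho
  end.

End norms.

Section open_sets.
Variable U : set E.

(* D k extends the k-th Frechet derivative of f to E; its values outside the
   open set U are irrelevant. *)
Definition frechet_derivs (f : U -> F) (D : jet E F E) :=
  (forall (x : U) v, D 0%N (val x) v = f x) /\
  (forall k x, U x -> is_diff x (D k) (fun h => lsym_plug 1 (D (1 + k)%N x) h)).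

Definition frechet_smooth (f : U -> F) := exists D, frechet_derivs f D.

Definition jinf (K : set E) (f : U -> F) : jet E F K :=
  fun k x => xget 0 (frechet_derivs f) k (val x).

Definition CM_open (b : flavour) : lcs (U -> F) :=
  lcs_initial frechet_smooth
    [set K : set E | [/\ compact K, convex_set K & K `<=` U]]
    jinf (fun K => CM_compact K b).

End open_sets.
End jet_spaces.

Section tvs_notions.
Context {R : realType} {E : tvsType R}.

Definition mackey_cauchy (x : nat -> E) := exists B : set E,
  [/\ lcs_bounded (lcs_of_tvs E) B, absconvex B &
   exists2 mu : nat * nat -> R, mu @ (filter_prod \oo \oo) --> (0 : R) &
     forall n m, [set mu (n, m) *: b | b in B] (x n - x m)].

Definition mackey_complete :=
  forall x : nat -> E, mackey_cauchy x ->
    exists l : E, x @ \oo --> l.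

Definition smooth_curve (c : R -> E) := exists2 d : nat -> R -> E, d 0%N = c &
  forall n t, h^-1 *: (d n (t + h) - d n t) @[h --> (0 : R)^'] --> d n.+1 t.

Definition cinfty_open (U : set E) :=
  forall c : R -> E, smooth_curve c -> open (c @^-1` U).

End tvs_notions.
Arguments mackey_complete {R} E.

HB.mixin Record Tvs_isConvenient (R : realType) E of Tvs R E := {
  convenient_hausdorff : hausdorff_space E ;
  convenient_complete : mackey_complete E }.

#[short(type="convenientType")]
HB.structure Definition Convenient (R : realType) :=
  {E of Tvs_isConvenient R E & Tvs R E}.

Definition smooth_map (R : realType) (F G : tvsType R) (U : set F)
    (f : U -> G) :=
  forall c : R -> U, smooth_curve (fun t => val (c t)) ->
    smooth_curve (fun t => f (c t)).

Definition lin_span (R : realType) (V : lmodType R) (B : set V) : set V :=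
  smallest (fun S : set V => submod_closed (fun x => x \in S)) B.

Definition minkowski (R : realType) (V : lmodType R) (B : set V) (x : V) : R :=
  inf [set r | 0 < r /\ [set r *: b | b in B] x].

(* E_B below is built for all such B; Hausdorffness makes the Minkowski
   functional of B definite, and Mackey completeness makes E_B complete. *)
Record bdisk (R : realType) (E : convenientType R) := MkBdisk {
  bdisk_set : set E ;
  bdisk_closed : closed bdisk_set ;
  bdisk_absconvex : absconvex bdisk_set ;
  bdisk_bounded : lcs_bounded (lcs_of_tvs E) bdisk_set }.

Section EB_pred.
Context {R : realType} {E : convenientType R} (B : bdisk E).

Definition EB_pred : {pred E} := fun x => x \in lin_span (bdisk_set B).

Lemma EB_submod_closed : submod_closed EB_pred.
Proof.
split=> [|a x y /set_mem xB /set_mem yB]; apply/mem_set => S [Sc BS].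
  by have [/set_mem] := Sc.
by have [_ Sl] := Sc; apply/set_mem/Sl; apply/mem_set; [exact: xB|exact: yB].
Qed.

HB.instance Definition _ :=
  GRing.isSubmodClosed.Build R E EB_pred EB_submod_closed.

End EB_pred.

Record EB (R : realType) (E : convenientType R) (B : bdisk E) := MkEB {
  EB_incl : E ;
  EB_inclP : EB_incl \in EB_pred B }.

Section EB_normed.
Context {R : realType} {E : convenientType R} (B : bdisk E).

HB.instance Definition _ := [isSub for @EB_incl R E B].
HB.instance Definition _ := [Choice of EB B by <:].
HB.instance Definition _ := [SubChoice_isSubLmodule of EB B by <:].

Local Notation D := (bdisk_set B).
Local Notation S x := [set r | 0 < r /\ [set r *: b | b in D] x].

Let D0 : D 0.
Proof.
have [[x Dx] /(_ 0 0 x x)] := bdisk_absconvex B.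
by rewrite !scale0r addr0 normr0 addr0; apply.
Qed.

Let Sadd x y r s : S x r -> S y s -> S (x + y) (r + s).
Proof.
move=> -[r0 [b Db <-]] [s0 [c Dc <-]]; have rs0 := addr_gt0 r0 s0.
split=> //; exists ((r / (r + s)) *: b + (s / (r + s)) *: c).
  have [_] := bdisk_absconvex B; apply=> //.
  by rewrite !gtr0_norm ?divr_gt0// -mulrDl divff// gt_eqF.
by rewrite scalerDr !scalerA !(mulrC (r + s)) !divfK// gt_eqF.
Qed.

Let Sscale a x r : a != 0 -> S x r -> S (a *: x) (`|a| * r).
Proof.
move=> a0 -[r0 [b Db <-]]; split; first by rewrite mulr_gt0 ?normr_gt0.
exists ((a / `|a|) *: b + 0 *: b).
  have [_] := bdisk_absconvex B; apply=> //.
  by rewrite normrM normfV normr_id divff ?normr_eq0// normr0 addr0.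
rewrite scale0r addr0 !scalerA; congr (_ *: _).
by rewrite mulrAC mulrCA divff ?normr_eq0// mulr1.
Qed.

Let S0 r : 0 < r -> S 0 r.
Proof. by move=> r0; split=> //; exists 0 => //; rewrite scaler0. Qed.

Let Sspan x : x \in EB_pred B -> S x !=set0.
Proof.
move=> /set_mem /(_ [set x | S x !=set0]); apply; split.
  split; first by apply/mem_set; exists 1; exact: S0.
  move=> a y z /set_mem[r Sr] /set_mem[s Ss]; apply/mem_set => /=.
  have [->|a0] := eqVneq a 0; first by exists s; rewrite scale0r add0r.
  by exists (`|a| * r + s); apply: Sadd => //; exact: Sscale.
by move=> y Dy; exists 1; split=> //; exists y => //; rewrite scale1r.
Qed.

Let Sinf x : x \in EB_pred B -> has_inf (S x).
Proof. by move=> /Sspan Sx; split=> //; exists 0 => r [/ltW]. Qed.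

Let mink_lb x r : S x r -> minkowski D x <= r.
Proof. by move=> Sr; apply: ge_inf => //; exists 0 => s [/ltW]. Qed.

Let mink_ge x m : x \in EB_pred B -> (forall r, S x r -> m <= r) ->
  m <= minkowski D x.
Proof. by move=> xB mS; apply: lb_le_inf => //; exact: Sspan. Qed.

Let mink0 : minkowski D 0 = 0.
Proof.
apply/eqP; rewrite eq_le; apply/andP; split; last first.
  by apply: mink_ge => [|r [/ltW]//]; exact: rpred0.
by apply/ler_addgt0Pl => e e0; rewrite addr0 mink_lb//; exact: S0.
Qed.

Let norm (x : EB B) := minkowski D (EB_incl x).

Let ler_normD (x y : EB B) : norm (x + y) <= norm x + norm y.
Proof.
rewrite -lerBlDr; apply: (@mink_ge (EB_incl x) _ (EB_inclP x)) => r Sr.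
rewrite lerBlDr -lerBlDl.
apply: (@mink_ge (EB_incl y) _ (EB_inclP y)) => s Ss.
by rewrite lerBlDl; apply: mink_lb; exact: Sadd.
Qed.

Let normZ (a : R) (x : EB B) : norm (a *: x) = `|a| * norm x.
Proof.
have [->|a0] := eqVneq a 0.
  by rewrite scale0r normr0 mul0r; exact: mink0.
have le b (y : EB B) : b != 0 -> norm (b *: y) <= `|b| * norm y.
  move=> b0; rewrite -ler_pdivrMl ?normr_gt0//.
  apply: (@mink_ge (EB_incl y) _ (EB_inclP y)) => r Sr.
  rewrite ler_pdivrMl ?normr_gt0//; apply: mink_lb; exact: Sscale.
apply/eqP; rewrite eq_le le// andTb.
have := le a^-1 (a *: x); rewrite invr_eq0 => /(_ a0).
by rewrite scalerA mulVf// scale1r normfV ler_pdivlMl ?normr_gt0.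
Qed.

Let norm_eq0 (x : EB B) : norm x = 0 -> x = 0.
Proof.
move=> x0; apply/val_inj/(@convenient_hausdorff R E) => /= N P Nx P0.
exists (EB_incl x); split; first exact: nbhs_singleton.
have := @scale_continuous R E (0, 0) P; rewrite /= scale0r => /(_ P0).
move=> [[V W]/= [/nbhs_ballP[e /= e0 eV] W0] VWP].
have [_ /(_ W W0)[t t0 DW]] := bdisk_bounded B.
have : exists2 r, S (EB_incl x) r & r < e / t.
  apply/not_exists2P => H.
  have : e / t <= norm x.
    apply: (@mink_ge (EB_incl x) _ (EB_inclP x)) => r Sr.
    by case: (H r) => // /negP; rewrite -leNgt.
  by rewrite x0 leNgt divr_gt0.
move=> [r [r0 [b Db <-]] ret].
have [w Ww <-] := DW b Db.
rewrite scalerA; apply: (VWP (r * t, w)); split=> //=.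
apply: eV; rewrite /ball/= sub0r normrN gtr0_norm ?mulr_gt0//.
by rewrite -ltr_pdivlMr.
Qed.

HB.instance Definition _ := @Lmodule_isNormed.Build R (EB B)
  norm ler_normD normZ norm_eq0.

End EB_normed.

Section CM.
Context {R : realType} {F G : convenientType R} (M : nat -> R) (b : flavour).
Variable U : set F.

Definition trace (B : bdisk F) : set (EB B) := [set x | U (EB_incl x)].
Arguments trace B : clear implicits.

Definition trace_incl (B : bdisk F) (x : trace B) : U :=
  exist _ (EB_incl (val x)) (mem_set (set_mem (valP x) : U _)).

Definition CM : lcs (U -> G) :=
  lcs_initial (@smooth_map R F G U)
    [set i : {linear G -> R^o} * bdisk F | continuous i.1]
    (fun i (f : U -> G) (x : trace i.2) => i.1 (f (trace_incl x)) : R^o)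
    (fun i => @CM_open R (EB i.2) R^o M (trace i.2) b).

End CM.
Arguments CM {R F} G M b U.

(* Main.v *)
(** For a closed bounded disk [B] of a convenient vector space [E] the space
    [E_B] is a Banach space, and a linear map on [E] is bounded as soon as its
    restriction to each [E_B] is continuous at [0].  Let all [ev_x \o T] be
    bounded.  For [l] in the dual of [G] and a disk [D] of [F], the derivative
    [d^k (l \o T e \o i_D) (x) (v)] is, as a function of [e] in [E_B], an
    iterated limit of difference quotients of values [l (T e y)] along lines,
    which are smooth curves and therefore stay in [U] for a short time; by
    Banach-Steinhaus it is a continuous linear functional of [e].  The sublevel
    sets of [e |-> jnorm_rho M rho (l \o T e \o i_D)] are thus closed and
    absolutely convex, and by Baire the finiteness of these norms (for each
    [rho], or for some [rho] depending on [e]) makes one of them a neighbourhood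
    of [0].  Conversely, boundedness in [C^[M]] bounds [l (T a x)] for every
    continuous functional [l], and weakly bounded sets are bounded by Mackey's
    theorem. *)
Require Import Defs.
From HB Require Import structures.
From mathcomp Require Import all_boot all_order all_algebra.
From mathcomp Require Import all_classical all_reals all_analysis.
From mathcomp Require Import ring lra.

Set Implicit Arguments.
Unset Strict Implicit.
Unset Printing Implicit Defensive.

Import Order.TTheory GRing.Theory Num.Theory.
Import numFieldNormedType.Exports.

Local Open Scope classical_set_scope.
Local Open Scope ring_scope.

(** * Absolutely convex sets and Banach spaces *)

Section absconvex.
Context {R : realType} {V : lmodType R}.
Implicit Types (A : set V) (a : R).

Lemma absconvex0 A : absconvex A -> A 0.
Proof.
move=> [[x Ax] /(_ 0 0 x x)].
by rewrite !scale0r addr0 normr0 addr0; exact.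
Qed.

Lemma absconvexZ A a x : absconvex A -> `|a| <= 1 -> A x -> A (a *: x).
Proof.
move=> [_ cA] a1 Ax; have := cA a 0 x x; rewrite scale0r addr0 normr0 addr0.
exact.
Qed.

Lemma absconvex_bigcap (I : Type) (D : set I) (A : I -> set V) :
  (forall i, D i -> absconvex (A i)) -> absconvex (\bigcap_(i in D) A i).
Proof.
move=> aA; split=> [|a b x y ab Ax Ay i Di].
  by exists 0 => i /aA /absconvex0.
by apply: (aA i Di).2 => //; [exact: Ax|exact: Ay].
Qed.

Lemma convex_symmetric_absconvex A : convex_set (A : set (convex_lmodType V)) ->
  A 0 -> (forall x, A x -> A (- x)) -> absconvex A.
Proof.
move=> cA A0 AN; split; first by exists 0.
have segment x y (t : R) : 0 <= t -> t <= 1 -> A x -> A y ->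
    A (t *: x + (1 - t) *: y).
  move=> t0 t1 Ax Ay.
  by have /set_mem := cA x y (Itv01 t0 t1) (mem_set Ax) (mem_set Ay).
have abs_scale a x : A x -> exists2 y, A y & a *: x = `|a| *: y.
  move=> Ax; have [a0|a0] := leP 0 a; first by exists x; rewrite // ger0_norm.
  by exists (- x); [exact: AN|rewrite ltr0_norm// scalerN scaleNr opprK].
move=> a b x y ab /(abs_scale a)[{}x Ax ->] /(abs_scale b)[{}y Ay ->].
move: (normr_ge0 a) (normr_ge0 b) ab; move: `|a| `|b| => {}a {}b a0 b0 ab.
have [s0|s0] := eqVneq (a + b) 0.
  have [-> ->] : a = 0 /\ b = 0 by split; lra.
  by rewrite !scale0r addr0.
have {}s0 : 0 < a + b by rewrite lt_def s0 addr_ge0.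
have Az : A ((a / (a + b)) *: x + (1 - a / (a + b)) *: y).
  apply: segment => //; first by rewrite divr_ge0// ltW.
  by rewrite ler_pdivrMr// mul1r lerDl.
have := segment _ 0 (a + b) (ltW s0) ab Az A0; rewrite scaler0 addr0.
rewrite scalerDr !scalerA mulrBr mulr1 [(a + b) * _]mulrC divfK ?gt_eqF//.
by rewrite [a + b]addrC addrK.
Qed.

End absconvex.

Lemma absconvex_nbhs0 (R : realType) (E : tvsType R) (A : set E) (x : E) :
  absconvex A -> nbhs x A -> nbhs (0 : E) A.
Proof.
move=> [_ cA] Ax; have := nbhsB (- x) Ax; rewrite addNr => A0.
apply: filterS2 A0 (nbhs0N A0) => _ [y Ay <-] [_ [z Az <-] yz].
have -> : - x + y = 2^-1 *: y + (- 2^-1) *: z.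
  rewrite scaleNr -scalerBr.
  apply: (scalerI (a := 2)); first by rewrite pnatr_eq0.
  rewrite scalerA divff ?pnatr_eq0// scale1r scaler_nat mulr2n.
  by rewrite -{2}yz opprD opprK addrACA addNr add0r.
by apply: cA => //; rewrite normrN gtr0_norm//; lra.
Qed.

Lemma baire_absconvex (R : realType) (V : completeNormedModType R)
    (A : nat -> set V) :
  (forall n, closed (A n)) -> (forall n, absconvex (A n)) ->
  (forall x, exists n, A n x) -> exists n, nbhs (0 : V) (A n).
Proof.
move=> clA aA cover; apply: contrapT => /forallNP noint.
have compl_dense n : open (~` A n) /\ dense (~` A n).
  split=> [|O [x Ox] Oo]; first exact: closed_openC.
  apply: contrapT => /nonemptyPn OA.
  apply: (noint n); apply: (absconvex_nbhs0 (aA n)) (_ : nbhs x _).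
  apply: filterS (open_nbhs_nbhs (conj Oo Ox)).
  by apply/subsets_disjoint.
have [x [_ xA]] := Baire compl_dense (ex_intro _ 0 I) openT.
by have [n Anx] := cover x; exact: (xA n).
Qed.

Definition pack_linear (R : pzRingType) (V W : lmodType R) (f : V -> W)
    (lf : linear f) : {linear V -> W} :=
  HB.pack f (GRing.isLinear.Build _ _ _ _ _ lf).

Lemma linear_cvg (R : realType) (V : lmodType R) (W : normedModType R)
    (T : Type) (F : set_system T) (f : T -> V -> W) (g : V -> W) :
  ProperFilter F -> (\forall t \near F, linear (f t)) ->
  (forall x, f t x @[t --> F] --> g x) -> linear g.
Proof.
move=> FF lf fg a x y.
have : a *: f t x + f t y @[t --> F] --> a *: g x + g y.
  by apply: cvgD; [apply: cvgZl_tmp|]; exact: fg.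
apply: cvg_unique => //; apply: cvg_trans (fg _); apply: near_eq_cvg.
by apply: filterS lf => t ->.
Qed.

Section continuous_linear.
Context {R : realType} {V W : normedModType R}.
Implicit Types f g : V -> W.

Definition continuous_linear f := linear f /\ continuous f.

Lemma bounded_continuous_linear f c : linear f ->
  (forall x, `|x| < 1 -> `|f x| <= c) -> continuous_linear f.
Proof.
move=> lf fc; split=> //.
apply: (@bounded_linear_continuous _ _ _ (pack_linear lf)).
apply/ex_bound; exists c; apply/nbhs_normP; exists 1 => //= x.
by rewrite /= sub0r normrN; exact: fc.
Qed.

Lemma continuous_linear_bounded_fun_norm f : continuous_linear f ->
  bounded_fun_norm f.
Proof.
move=> [lf cf]; apply/(bounded_funP (pack_linear lf)).
exact/(linear_bounded_continuous (pack_linear lf)).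
Qed.

Lemma continuous_linear_lincomb a b f g :
  continuous_linear f -> continuous_linear g ->
  continuous_linear (fun x => a *: f x + b *: g x).
Proof.
move=> [lf cf] [lg cg]; split=> [c x y|x].
  by rewrite lf lg !scalerDr addrACA !scalerA ![_ * c]mulrC.
by apply: cvgD; apply: cvgZl_tmp; [exact: cf|exact: cg].
Qed.

End continuous_linear.

Lemma continuous_linear_cvg (R : realType) (V : completeNormedModType R)
    (W : normedModType R) (f : nat -> V -> W) (g : V -> W) :
  (\forall n \near \oo, continuous_linear (f n)) ->
  (forall x, f n x @[n --> \oo] --> g x) -> continuous_linear g.
Proof.
move=> clf fg; have lg : linear g.
  by apply: (linear_cvg _ _ fg); apply: filterS clf => n [].
have [N _ clfN] := clf; pose tail := [set f n | n in [set n | N <= n]%N].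
have tail_cl h : tail h -> bounded_fun_norm h /\ linear h.
  move=> [n /clfN clfn <-]; split; last exact: clfn.1.
  exact: continuous_linear_bounded_fun_norm.
have tail_bounded : pointwise_bounded tail.
  move=> x; have /cvg_seq_bounded/pinfty_ex_gt0[c _ fc] := cvgP _ (fg x).
  by exists c => _ [n _ <-]; exact: fc.
have [c fc] := Banach_Steinhauss tail_cl tail_bounded 1.
apply: (bounded_continuous_linear lg (c := c)) => x /ltW x1.
have : `|f n x| @[n --> \oo] --> `|g x| by exact: cvg_norm.
by move=> /cvgr_to_le; apply; exists N => // n Nn; apply: fc; first exists n.
Qed.

(** * The Hahn-Banach theorem *)

Section subspaces.
Context {R : realType} {V : lmodType R}.

Definition subspace (H : set V) :=
  H 0 /\ forall a u v, H u -> H v -> H (a *: u + v).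

Lemma subspaceZ H a u : subspace H -> H u -> H (a *: u).
Proof. by move=> [H0 Hl] Hu; rewrite -[a *: u]addr0; exact: Hl. Qed.

Lemma subspaceB H u v : subspace H -> H u -> H v -> H (u - v).
Proof. by move=> [_ Hl] Hu Hv; rewrite addrC -scaleN1r; exact: Hl. Qed.

Lemma subspace_bigcup (C : set (set V)) : C !=set0 -> total_on C subset ->
  (forall H, C H -> subspace H) -> subspace (\bigcup_(H in C) H).
Proof.
move=> [H0 CH0] Ctot Csub; split.
  by exists H0 => //; exact: (Csub _ CH0).1.
move=> a u v [H CH Hu] [K CK Kv].
have [HK|KH] := Ctot H K CH CK.
  by exists K => //; apply: (Csub K CK).2 => //; exact: HK.
by exists H => //; apply: (Csub H CH).2 => //; exact: KH.
Qed.

Lemma subspace_addline (H : set V) (z : V) : subspace H ->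
  subspace [set w | exists t, H (w - t *: z)].
Proof.
move=> [H0 Hl]; split; first by exists 0; rewrite scale0r subr0.
move=> a u v [t Hu] [s Hv]; exists (a * t + s).
by rewrite scalerDl -scalerA opprD addrACA -scalerBr; exact: Hl.
Qed.

Lemma subspaceI_absconvex (H A : set V) :
  subspace H -> absconvex A -> absconvex (H `&` A).
Proof.
move=> sH aA; split; first by exists 0; split; [exact: sH.1|exact: absconvex0].
move=> a b x y ab [Hx Ax] [Hy Ay]; split; last exact: aA.2.
by apply: sH.2 => //; exact: subspaceZ.
Qed.

End subspaces.

Section hahn_banach.
Context {R : realType} {V : lmodType R}.
Implicit Types (p : V -> R) (H : set (V * R^o)).

Definition sublinear p := (forall x y, p (x + y) <= p x + p y) /\
  (forall a x, 0 <= a -> p (a *: x) = a * p x).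

Lemma sublinear0 p : sublinear p -> p 0 = 0.
Proof. by move=> [_ /(_ 0 0 (lexx _))]; rewrite scale0r mul0r. Qed.

(* A linear functional on a subspace of V is represented by its graph in
   V * R^o; domination by p makes the graph single-valued. *)
Definition dominated p H := forall u, H u -> u.2 <= p u.1.

Lemma dominated_gap p H x0 : sublinear p -> subspace H -> dominated p H ->
  exists a, (forall u, H u -> u.2 - p (u.1 - x0) <= a) /\
            (forall u, H u -> a <= p (u.1 + x0) - u.2).
Proof.
move=> [pD _] [H0 Hl] Hp; pose S := [set u.2 - p (u.1 - x0) | u in H].
have below u v : H u -> H v -> u.2 - p (u.1 - x0) <= p (v.1 + x0) - v.2.
  move=> Hu Hv; have := Hp _ (Hl 1 u v Hu Hv); rewrite /= !scale1r.
  have := pD (u.1 - x0) (v.1 + x0); rewrite addrACA addNr addr0.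
  by lra.
have S0 : S !=set0 by exists (0 - p (0 - x0)), 0.
exists (sup S); split=> u Hu.
  apply: ub_le_sup; last by exists u.
  by exists (p (0 + x0) - 0) => _ [v Hv <-]; exact: below H0.
by apply: ge_sup => // _ [v Hv <-]; exact: below.
Qed.

Lemma dominated_extend p H x0 : sublinear p -> subspace H -> dominated p H ->
  exists a, dominated p [set w | exists t, H (w - t *: (x0, a))].
Proof.
move=> sp sH Hp; have [a [age ale]] := dominated_gap x0 sp sH Hp.
exists a => -[x c] [t Ht]; have [t0|t0|t0] := ltgtP t 0; last first.
- by have := Hp _ Ht; rewrite /= t0 scale0r subr0 scale0r subr0.
- have : a <= p (t^-1 *: (x - t *: x0) + x0) - t^-1 * (c - t * a).
    exact: ale (subspaceZ t^-1 sH Ht).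
  have -> : t^-1 *: (x - t *: x0) + x0 = t^-1 *: x.
    by rewrite scalerBr scalerA mulVf ?gt_eqF// scale1r subrK.
  by rewrite sp.2 ?invr_ge0 ?(ltW t0)// -mulrBr ler_pdivlMl//=; lra.
- have : (- t)^-1 * (c - t * a) - p ((- t)^-1 *: (x - t *: x0) - x0) <= a.
    exact: age (subspaceZ (- t)^-1 sH Ht).
  have nt0 : 0 < - t by rewrite oppr_gt0.
  have -> : (- t)^-1 *: (x - t *: x0) - x0 = (- t)^-1 *: x.
    rewrite scalerBr scalerA invrN mulNr mulVf ?lt_eqF//.
    by rewrite scaleN1r opprK addrK.
  by rewrite sp.2 ?invr_ge0 ?(ltW nt0)// -mulrBr ler_pdivrMl//=; lra.
Qed.

Lemma maximal_dominated p H : subspace H -> dominated p H ->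
  exists K, [/\ subspace K, dominated p K, H `<=` K &
    forall L, subspace L -> dominated p L -> K `<=` L -> L `<=` K].
Proof.
move=> sH Hp; pose good A := subspace (H `|` A) /\ dominated p (H `|` A).
have [C Cgood Ctot|A [[sHA HAp] Amax]] := @Zorn_bigcup _ good.
  have [->|/set0P[A0 CA0]] := eqVneq C set0.
    by rewrite /good bigcup_set0 setU0.
  split=> [|u [/Hp//|[A CA Au]]]; last by apply: (Cgood A CA).2; right.
  have -> : H `|` \bigcup_(A in C) A = \bigcup_(K in (setU H @` C)) K.
    rewrite bigcup_image.
    apply/seteqP; split=> [u [Hu|[A CA Au]]|u [A CA [Hu|Au]]].
    - by exists A0 => //; left.
    - by exists A => //; right.
    - by left.
    - by right; exists A.
  apply: subspace_bigcup; first by exists (H `|` A0), A0.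
    move=> _ _ [A CA <-] [B CB <-].
    by have [AB|BA] := Ctot A B CA CB; [left|right]; exact: setUS.
  by move=> _ [A CA <-]; exact: (Cgood A CA).1.
exists (H `|` A); split=> // L sL Lp HAL; apply: contrapT => LHA.
have [HL AL] : H `<=` L /\ A `<=` L by move: HAL; rewrite subUset.
apply: (Amax L); first by split=> // LA; apply: LHA => u /LA; right.
by rewrite /good (setUidr HL).
Qed.

Theorem hahn_banach p H : sublinear p -> subspace H -> dominated p H ->
  exists f : {linear V -> R^o},
    (forall x, f x <= p x) /\ (forall u, H u -> f u.1 = u.2).
Proof.
move=> sp sH Hp; have [K [sK Kp HK Kmax]] := maximal_dominated sH Hp.
have total x : exists a, K (x, a).
  have [a Ka] := dominated_extend x sp sK Kp; exists a.
  apply: (Kmax _ (subspace_addline (x, a) sK) Ka).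
    by move=> u Ku; exists 0; rewrite scale0r subr0.
  by exists 1; rewrite scale1r subrr; exact: sK.1.
have le_value x a c : K (x, a) -> K (x, c) -> a <= c.
  move=> Ka Kc; have := Kp _ (subspaceB sK Ka Kc).
  by rewrite /= subrr sublinear0// subr_le0.
have value_uniq x a c : K (x, a) -> K (x, c) -> a = c.
  by move=> Ka Kc; apply/eqP; rewrite eq_le !(le_value x).
have /choice[f fK] := total.
have lf : linear (f : V -> R^o).
  by move=> a x y; apply: value_uniq (fK _) (sK.2 a _ _ (fK x) (fK y)).
exists (pack_linear lf); split=> [x|[x a] /HK]; first exact: Kp _ (fK x).
exact: value_uniq.
Qed.

End hahn_banach.

Section seminorms.
Context {R : realType} {V : lmodType R}.
Implicit Types p : V -> R.

Definition seminorm p :=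
  (forall x y, p (x + y) <= p x + p y) /\ (forall a x, p (a *: x) = `|a| * p x).

Lemma seminorm_sublinear p : seminorm p -> sublinear p.
Proof. by move=> [pD pZ]; split=> // a x a0; rewrite pZ ger0_norm. Qed.

Lemma seminorm0 p : seminorm p -> p 0 = 0.
Proof. by move=> /seminorm_sublinear/sublinear0. Qed.

Lemma seminormN p x : seminorm p -> p (- x) = p x.
Proof. by move=> [_ pZ]; rewrite -scaleN1r pZ normrN1 mul1r. Qed.

Lemma seminorm_distC p x y : seminorm p -> p (x - y) = p (y - x).
Proof. by move=> sp; rewrite -opprB seminormN. Qed.

Lemma seminorm_ge0 p x : seminorm p -> 0 <= p x.
Proof.
move=> sp; have := sp.1 x (- x).
by rewrite subrr seminorm0// seminormN//; lra.
Qed.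

Lemma seminorm_dist_dist p x y : seminorm p -> `|p x - p y| <= p (x - y).
Proof.
move=> sp; have := sp.1 (x - y) y; have := sp.1 (y - x) x.
rewrite !subrK (seminorm_distC y)// ler_norml => pyx pxy.
by apply/andP; split; lra.
Qed.

Lemma seminorm_absconvex p c : seminorm p -> 0 <= c ->
  absconvex [set x | p x <= c].
Proof.
move=> sp c0; have [pD pZ] := sp; split.
  by exists 0; rewrite /= seminorm0.
move=> a b x y ab /= px py; rewrite (le_trans (pD _ _))// !pZ.
rewrite (@le_trans _ _ ((`|a| + `|b|) * c))//; last by rewrite ler_piMl.
by rewrite mulrDl lerD// ler_wpM2l.
Qed.

Lemma norm_linear_seminorm (W : normedModType R) (f : V -> W) : linear f ->
  seminorm (fun x => `|f x|).
Proof.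
move=> lf; split=> [x y|a x].
  by have /= -> := linearD (pack_linear lf) x y; exact: ler_normD.
by have /= -> := linearZ_LR (pack_linear lf) a x; exact: normrZ.
Qed.

Lemma norming_functional p v : seminorm p ->
  exists f : {linear V -> R^o}, (forall x, `|f x| <= p x) /\ f v = p v.
Proof.
move=> sp; pose line : set (V * R^o) := [set w | exists t, w = t *: (v, p v)].
have [||f [fp fline]] := hahn_banach (seminorm_sublinear sp) (H := line).
- split; first by exists 0; rewrite scale0r.
  by move=> a _ _ [t ->] [s ->]; exists (a * t + s); rewrite scalerDl scalerA.
- move=> _ [t ->]; rewrite /= sp.2 ler_wpM2r ?seminorm_ge0//.
  exact: ler_norm.
exists f; split=> [x|]; last first.
  by apply: (fline (v, p v)); exists 1; rewrite scale1r.
by rewrite ler_norml fp lerNl -linearN -(seminormN x sp) fp.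
Qed.

End seminorms.

(** * Bounded sets and Banach disks *)

Local Notation minkowski := Defs.minkowski.

Definition absorbing (R : realType) (V : lmodType R) (A : set V) :=
  forall x, exists2 r : R, 0 < r & [set r *: y | y in A] x.

Section minkowski.
Context {R : realType} {V : lmodType R} (A : set V).
Hypothesis aA : absconvex A.

Lemma absconvex_scaledD x y r s : 0 < r -> 0 < s ->
  [set r *: z | z in A] x -> [set s *: z | z in A] y ->
  [set (r + s) *: z | z in A] (x + y).
Proof.
move=> r0 s0 [u Au <-] [v Av <-]; have rs0 := addr_gt0 r0 s0.
exists ((r / (r + s)) *: u + (s / (r + s)) *: v).
  by apply: aA.2 => //; rewrite !gtr0_norm ?divr_gt0// -mulrDl divff ?gt_eqF.
by rewrite scalerDr !scalerA ![(r + s) * _]mulrC !divfK ?gt_eqF.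
Qed.

Lemma absconvex_scaledZ a x r : a != 0 ->
  [set r *: z | z in A] x -> [set (`|a| * r) *: z | z in A] (a *: x).
Proof.
move=> a0 [u Au <-]; exists ((a / `|a|) *: u).
  by apply: absconvexZ; rewrite // normrM normfV normr_id divff ?normr_eq0.
rewrite !scalerA; congr (_ *: _).
by rewrite mulrAC mulrCA divff ?normr_eq0// mulr1.
Qed.

Lemma minkowski_le x r : 0 < r -> [set r *: z | z in A] x -> minkowski A x <= r.
Proof. by move=> r0 rx; apply: ge_inf => //; exists 0 => s [/ltW]. Qed.

Lemma minkowski_lt x r : (exists2 s : R, 0 < s & [set s *: z | z in A] x) ->
  minkowski A x < r -> [set r *: z | z in A] x.
Proof.
move=> [t t0 tx] /inf_lt[]; first by exists t.
move=> s [s0 [y Ay <-]] sr; have r0 := lt_trans s0 sr.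
exists ((s / r) *: y); last by rewrite scalerA mulrC divfK ?gt_eqF.
by apply: absconvexZ; rewrite // gtr0_norm ?divr_gt0// ler_pdivrMr// mul1r ltW.
Qed.

Lemma minkowski_seminorm : absorbing A -> seminorm (minkowski A).
Proof.
move=> absorbA.
have mink_ge0 x : 0 <= minkowski A x.
  by have [r r0 rx] := absorbA x; apply: lb_le_inf => [|s [/ltW]//]; exists r.
have inA x e : 0 < e -> [set (minkowski A x + e) *: z | z in A] x.
  by move=> e0; apply: minkowski_lt; rewrite // ltrDl.
have minkZ_le a x : a != 0 -> minkowski A (a *: x) <= `|a| * minkowski A x.
  move=> a0; have na0 : 0 < `|a| by rewrite normr_gt0.
  apply/ler_addgt0Pr => e e0; have ea0 : 0 < e / `|a| by rewrite divr_gt0.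
  have -> : `|a| * minkowski A x + e = `|a| * (minkowski A x + e / `|a|).
    by rewrite mulrDr mulrCA divff ?mulr1 ?gt_eqF.
  apply: minkowski_le; first by rewrite mulr_gt0// ltr_wpDl.
  by apply: absconvex_scaledZ => //; exact: inA.
split=> [x y|a x].
  apply/ler_addgt0Pr => e e0; have e20 : 0 < e / 2 by rewrite divr_gt0.
  rewrite (splitr e) addrACA.
  apply: minkowski_le; first by rewrite addr_gt0 ?ltr_wpDl.
  by apply: absconvex_scaledD; rewrite ?ltr_wpDl//; exact: inA.
have [->|a0] := eqVneq a 0.
  rewrite scale0r normr0 mul0r; apply/eqP; rewrite eq_le mink_ge0 andbT.
  apply/ler_addgt0Pr => e e0; rewrite add0r; apply: minkowski_le => //.
  by exists 0; [exact: absconvex0|rewrite scaler0].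
apply/eqP; rewrite eq_le minkZ_le// andTb -ler_pdivlMl ?normr_gt0//.
have := minkZ_le a^-1 (a *: x); rewrite invr_eq0 => /(_ a0).
by rewrite scalerA mulVf// scale1r normfV.
Qed.

End minkowski.

Section continuous_seminorms.
Context {R : realType} {E : tvsType R}.
Implicit Types (A N : set E) (p : E -> R).

Lemma nbhs0_absconvex N : nbhs (0 : E) N ->
  exists W, [/\ absconvex W, nbhs (0 : E) W & W `<=` N].
Proof.
move=> N0; have [B Bconv [Bopen Bbasis]] := @locally_convex R E.
have [U [BU U0] UN] := Bbasis 0 N N0.
have nU : nbhs (0 : E) U by apply: open_nbhs_nbhs; split=> //; exact: Bopen.
exists [set x | U x /\ U (- x)]; split; last by move=> x [/UN].
- apply: convex_symmetric_absconvex; last 2 first.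
  + by rewrite /= oppr0.
  + by move=> x [Ux UNx]; rewrite /= opprK.
  move=> x y t /set_mem[Ux UNx] /set_mem[Uy UNy]; apply/mem_set.
  split; first by apply/set_mem/(Bconv U (mem_set BU)); exact: mem_set.
  have := Bconv U (mem_set BU) (- x) (- y) t (mem_set UNx) (mem_set UNy).
  by move/set_mem; congr U; rewrite opprD -!scalerN.
- by apply: filterI => //; have := @opp_continuous E 0 U; rewrite oppr0; exact.
Qed.

Lemma nbhs0_absorbing N : nbhs (0 : E) N -> absorbing N.
Proof.
move=> N0 x; have := @scale_continuous R E (0, x) N.
rewrite /= scale0r => /(_ N0).
move=> [[P Q]/= [/nbhs_ballP[e /= e0 eP] Qx] PQN].
have e20 : 0 < e / 2 by rewrite divr_gt0.
exists (e / 2)^-1; first by rewrite invr_gt0.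
exists ((e / 2) *: x); last by rewrite scalerA mulVf ?gt_eqF// scale1r.
apply: (PQN (e / 2, x)); split=> /=; last exact: nbhs_singleton.
by apply: eP; rewrite /ball/= sub0r normrN gtr0_norm//; lra.
Qed.

Definition continuous_seminorm p :=
  seminorm p /\ nbhs (0 : E) [set x | p x < 1].

Lemma nbhs0_seminorm N : nbhs (0 : E) N ->
  exists2 p, continuous_seminorm p & [set x | p x < 1] `<=` N.
Proof.
move=> /nbhs0_absconvex[W [aW nW WN]].
have absorbW := nbhs0_absorbing nW.
exists (minkowski W); last first.
  move=> x /(minkowski_lt aW (absorbW x))[y Wy <-].
  by rewrite scale1r; exact: WN.
split; first exact: minkowski_seminorm.
have half0 : (2^-1 : R) != 0 by rewrite invr_eq0 pnatr_eq0.
apply: filterS (nbhs0Z half0 nW) => _ [y Wy <-] /=.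
apply: (@le_lt_trans _ _ 2^-1); last by lra.
by apply: minkowski_le; [lra|exists y].
Qed.

Lemma continuous_seminorm_ball p x e : continuous_seminorm p -> 0 < e ->
  nbhs x [set y | p (y - x) < e].
Proof.
move=> [sp np] e0; have := @nbhsT _ _ _ x (nbhs0Z (lt0r_neq0 e0) np).
apply: filterS => _ [_ [y py <-] <-] /=.
by rewrite addrAC subrr add0r sp.2 gtr0_norm// -ltr_pdivlMl// mulVf ?gt_eqF.
Qed.

Lemma continuous_seminorm_continuous p : continuous_seminorm p -> continuous p.
Proof.
move=> cp x; apply/cvgrPdist_lt => e e0.
apply: filterS (continuous_seminorm_ball x cp e0) => y /=.
apply: le_lt_trans; rewrite (seminorm_distC y x cp.1).
exact: seminorm_dist_dist cp.1.
Qed.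

Lemma normr_continuous_seminorm (l : {linear E -> R^o}) : continuous l ->
  continuous_seminorm (fun x => `|l x|).
Proof.
move=> cl; split; first exact: (norm_linear_seminorm (linearP l)).
have /cvgrPdist_lt/(_ 1 ltr01) := cl 0.
by apply: filterS => x /=; rewrite linear0 sub0r normrN.
Qed.

Lemma dominated_linear_continuous p (l : {linear E -> R^o}) :
  continuous_seminorm p -> (forall x, `|l x| <= p x) -> continuous l.
Proof.
move=> cp lp x; apply/cvgrPdist_lt => e e0.
apply: filterS (continuous_seminorm_ball x cp e0) => y /=.
by apply: le_lt_trans; rewrite -(seminorm_distC x y cp.1) -linearB.
Qed.

Lemma lcs_bounded_seminormP A : lcs_bounded (lcs_of_tvs E) A <->
  forall p, continuous_seminorm p -> exists c, forall x, A x -> p x <= c.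
Proof.
split=> [[_ bA] p [sp np]|pA].
  have [r r0 Ar] := bA _ np; exists r => x /Ar[y /= py <-].
  by rewrite sp.2 gtr0_norm// ger_pMr// ltW.
split=> // N /nbhs0_seminorm[p cp pN]; have [c Ac] := pA p cp.
have d0 : 0 < `|c| + 1 by rewrite ltr_wpDl.
exists (`|c| + 1) => // x Ax; exists ((`|c| + 1)^-1 *: x).
  apply: pN; rewrite /= cp.1.2 gtr0_norm ?invr_gt0// ltr_pdivrMl// mulr1.
  by rewrite (le_lt_trans (Ac x Ax))// (le_lt_trans (ler_norm c))// ltrDl.
by rewrite scalerA divff ?gt_eqF// scale1r.
Qed.

Definition disk_hull A : set E := smallest (fun C => closed C /\ absconvex C) A.

Lemma disk_hull_closed A : closed (disk_hull A).
Proof. by apply: closed_bigI => C [[]]. Qed.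

Lemma disk_hull_absconvex A : absconvex (disk_hull A).
Proof. by apply: absconvex_bigcap => C [[]]. Qed.

Lemma disk_hull_bounded A : lcs_bounded (lcs_of_tvs E) A ->
  lcs_bounded (lcs_of_tvs E) (disk_hull A).
Proof.
move=> /lcs_bounded_seminormP bA; apply/lcs_bounded_seminormP => p cp.
have [c Ac] := bA p cp; exists `|c| => x; move: x.
apply: smallest_sub; last by move=> x /Ac /le_trans; apply; exact: ler_norm.
split; last exact: seminorm_absconvex cp.1 (normr_ge0 c).
apply: (@preimage_closed _ _ p [set y | y <= `|c|]); last exact: closed_le.
by move=> x _; exact: continuous_seminorm_continuous.
Qed.

Lemma bounded_set1 (x : E) : lcs_bounded (lcs_of_tvs E) [set x].
Proof. by apply/lcs_bounded_seminormP => p _; exists (p x) => _ ->. Qed.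

End continuous_seminorms.

Definition hull_bdisk (R : realType) (E : convenientType R) (A : set E)
    (bA : lcs_bounded (lcs_of_tvs E) A) : bdisk E :=
  MkBdisk (@disk_hull_closed _ _ A) (@disk_hull_absconvex _ _ A)
    (disk_hull_bounded bA).

Section banach_disk.
Context {R : realType} {E : convenientType R} (B : bdisk E).
Local Notation D := (bdisk_set B).
Implicit Types (x : EB B) (r : R).

Lemma bdisk_sub_EB y : D y -> y \in EB_pred B.
Proof. by move=> Dy; apply/mem_set => S [_]; apply. Qed.

Lemma EB_norm_le x r : 0 < r -> [set r *: y | y in D] (EB_incl x) -> `|x| <= r.
Proof. exact: minkowski_le. Qed.

Lemma EB_norm_lt x r : `|x| < r -> [set r *: y | y in D] (EB_incl x).
Proof.
move=> xr; have [sx|nosx] := pselect (exists2 s : R, 0 < s &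
    [set s *: y | y in D] (EB_incl x)).
  by apply: (minkowski_lt (bdisk_absconvex B) sx); exact: xr.
(* The norm is then the infimum of the empty set, which is 0. *)
have /normr0_eq0 -> : `|x| = 0.
  by apply: inf_out => -[[s [s0 sx]] _]; apply: nosx; exists s.
by exists 0; [exact: absconvex0 (bdisk_absconvex B)|rewrite scaler0].
Qed.

Lemma scaled_bdisk_closed r : 0 < r -> closed [set r *: y | y in D].
Proof.
move=> r0; have -> : [set r *: y | y in D] = *:%R r^-1 @^-1` D.
  apply/seteqP; split=> [_ [y Dy <-]|y Dy] /=.
    by rewrite scalerA mulVf ?gt_eqF// scale1r.
  by exists (r^-1 *: y) => //; rewrite scalerA divff ?gt_eqF// scale1r.
apply: preimage_closed; last exact: bdisk_closed.
move=> y _; apply: (@continuous2_cvg _ R^o E E _ _ (fun=> r^-1) _ *:%R).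
- exact: (@scale_continuous R E (_, _)).
- exact: cvg_cst.
- exact: cvg_id.
Qed.

(* The differences are bounded by D itself, so Mackey completeness provides a
   limit in E; it lies in E_B because D is closed. *)
Lemma EB_harmonic_limit (x : nat -> EB B) :
  (forall n m, `|x n - x m| < harmonic n + harmonic m) ->
  exists l : EB B, forall n, `|l - x n| <= harmonic n + harmonic n.
Proof.
move=> xdist.
have hh0 n : 0 < harmonic n + harmonic n :> R by rewrite addr_gt0 ?harmonic_gt0.
have [|l xl] := @convenient_complete R E (fun n => EB_incl (x n)).
  exists D; split; [exact: bdisk_bounded|exact: bdisk_absconvex|].
  exists (fun nm => harmonic nm.1 + harmonic nm.2).
    rewrite -[X in _ --> X](addr0 0); apply: cvgD.
      by apply: cvg_comp; [exact: cvg_fst|exact: cvg_harmonic].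
    by apply: cvg_comp; [exact: cvg_snd|exact: cvg_harmonic].
  by move=> n m; exact: EB_norm_lt (xdist n m).
have lx n : [set (harmonic n + harmonic n) *: y | y in D] (l - EB_incl (x n)).
  have sub_cvg : EB_incl (x m) - EB_incl (x n) @[m --> \oo] -->
      l - EB_incl (x n).
    apply: (@continuous2_cvg _ E E E _ _ _ (fun=> _) +%R) => //.
      exact: (@add_continuous E (_, _)).
    exact: cvg_cst.
  apply: (closed_cvg _ (scaled_bdisk_closed (hh0 n)) _ _ sub_cvg).
  exists n => // m nm; apply: (@EB_norm_lt (x m - x n)).
  by rewrite (lt_le_trans (xdist m n))// lerD2r lef_pV2 ?posrE// ler_nat.
have Dl : l \in EB_pred B.
  have [y Dy /eqP] := lx 0; rewrite -subr_eq opprK => /eqP <-.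
  by apply: rpredD; [exact/rpredZ/bdisk_sub_EB|exact: EB_inclP].
by exists (MkEB Dl) => n; apply: EB_norm_le => //; exact: lx.
Qed.

Lemma EB_cauchy_cvg (F : set_system (EB B)) :
  ProperFilter F -> cauchy F -> cvg F.
Proof.
move=> FF /cauchyP Fcauchy.
have /choice[x Fx] n := Fcauchy _ (@harmonic_gt0 R n).
have [n m|l lx] := @EB_harmonic_limit x.
  have [z [/=]] := filter_ex (filterI (Fx n) (Fx m)).
  rewrite -!ball_normE /= => xnz xmz.
  by rewrite (le_lt_trans (ler_distD z _ _))// ltrD// distrC.
apply/cvg_ex; exists l; apply/cvgrPdist_lt => e e0.
have e30 : 0 < e / 3 by rewrite divr_gt0.
have /cvgrPdist_lt/(_ _ e30)[n _ /(_ n (leqnn n))] := @cvg_harmonic R.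
rewrite sub0r normrN ger0_norm ?harmonic_ge0// => hn.
apply: filterS (Fx n) => z; rewrite -ball_normE => xz.
have {}xz : `|x n - z| < harmonic n by [].
by rewrite (le_lt_trans (ler_distD (x n) _ _))//; have := lx n; lra.
Qed.

HB.instance Definition _ := Uniform_isComplete.Build (EB B) EB_cauchy_cvg.

Lemma EB_continuous_linear (W : normedModType R) (f : E -> W) (c : R) :
  linear f -> (forall y, D y -> `|f y| <= c) ->
  continuous_linear (fun x : EB B => f (EB_incl x)).
Proof.
move=> lf fc; apply: (bounded_continuous_linear (c := c)).
  by move=> a x y; exact: lf.
by move=> x /EB_norm_lt[y Dy <-]; rewrite scale1r; exact: fc.
Qed.

End banach_disk.

Lemma bounded_map_bdisk (R : realType) (E : convenientType R) (V : lmodType R)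
    (Y : lcs V) (T : {linear E -> V}) :
  (forall x, lcs_carrier Y (T x)) ->
  (forall B : bdisk E, T (EB_incl x) @[x --> (0 : EB B)] --> lcs_nbhs0 Y) ->
  bounded_map (lcs_of_tvs E) Y T.
Proof.
move=> TY T0 A bA; split=> [_ [a _ <-]//|N YN].
have /nbhs_normP[e /= e0 eN] := T0 (hull_bdisk bA) N YN.
have e20 : 0 < e / 2 by rewrite divr_gt0.
exists (e / 2)^-1; first by rewrite invr_gt0.
move=> _ [a Aa <-]; exists (T ((e / 2) *: a)); last first.
  by rewrite linearZ scalerA mulVf ?gt_eqF// scale1r.
have Da : bdisk_set (hull_bdisk bA) a by exact: sub_gen_smallest.
apply: (eN ((e / 2) *: MkEB (bdisk_sub_EB Da))).
rewrite /= sub0r normrN; apply: (@le_lt_trans _ _ (e / 2)); last by lra.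
by apply: EB_norm_le => //; exists a.
Qed.

(** * Mackey's theorem *)

Lemma cvgn_geometric_increments (R : realType) (s : R^nat) (c q : R) :
  1 < q -> (forall n, `|s n.+1 - s n| <= c / q ^+ n.+1) ->
  cvgn s /\ forall n, `|limn s - s n| <= c / q ^+ n / (q - 1).
Proof.
move=> q1 sc; pose r n : R := c / q ^+ n / (q - 1).
have q0 : 0 < q := lt_trans ltr01 q1.
have rE n : c / q ^+ n.+1 = r n - r n.+1.
  rewrite /r exprS; field.
  by rewrite subr_eq0 expf_neq0 ?(gt_eqF q1) ?(gt_eqF q0).
have incr : nondecreasing_seq (s - r).
  apply/nondecreasing_seqP => n; rewrite -![(s - r) _]/(s _ - r _).
  by have := sc n; rewrite rE ler_norml => /andP[]; lra.
have decr : nonincreasing_seq (s + r).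
  apply/nonincreasing_seqP => n; rewrite -![(s + r) _]/(s _ + r _).
  by have := sc n; rewrite rE ler_norml => /andP[]; lra.
have r0 : r @ \oo --> 0.
  have -> : r = geometric (c / (q - 1)) q^-1.
    by apply/funext => n; rewrite /r /geometric /= exprVn mulrAC.
  by apply: cvg_geometric; rewrite gtr0_norm ?invr_gt0// invf_lt1.
have [|limE icvg dcvg] := adjacent_seq incr decr.
  have -> : s + r - (s - r) = r + r by rewrite opprB addrC addrA subrK.
  by rewrite -(addr0 0); exact: cvgD.
have scvg : s @ \oo --> limn (s - r).
  by have := cvgD icvg r0; rewrite subrK addr0; exact.
split=> [|n]; first exact: cvgP scvg.
rewrite (cvg_lim _ scvg)// ler_norml.
have := nondecreasing_cvgn_le incr icvg n.
have := nonincreasing_cvgn_ge decr dcvg n.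
rewrite limE -[(s + r) n]/(s n + r n) -[(s - r) n]/(s n - r n) -/(r n).
by move=> upper lower; apply/andP; split; lra.
Qed.

Section uniform_boundedness.
Context {R : realType} {V : lmodType R} (p : V -> R).

Lemma linear_geometric_increments (S : nat -> V -> R^o) (q : R) : 1 < q ->
  (forall n, linear (S n)) ->
  (forall n x, `|S n.+1 x - S n x| <= p x / q ^+ n.+1) ->
  exists f : {linear V -> R^o},
    forall n x, `|f x - S n x| <= p x / q ^+ n / (q - 1).
Proof.
move=> q1 Sl Sp; have Scvg x := cvgn_geometric_increments q1 (Sp ^~ x).
have fl : linear (fun x => limn (S ^~ x) : R^o).
  apply: (linear_cvg (F := \oo) (f := S)) => [|x]; first exact: nearW.
  exact: (Scvg x).1.
by exists (pack_linear fl) => n x; exact: (Scvg x).2.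
Qed.

(* The functional is the sum of the norming functionals of the x n with weights
   3 ^- n.+1; the sign of each is chosen so that it does not cancel the previous
   partial sum at x n, and the later terms cancel at most half of its value. *)
Lemma gliding_hump_functional (x : nat -> V) : seminorm p ->
  exists f : {linear V -> R^o}, (forall y, `|f y| <= p y) /\
    forall n, p (x n) / 3 ^+ n.+1 / 2 <= `|f (x n)|.
Proof.
move=> sp; have /choice[g gP] n := norming_functional (x n) sp.
pose k n (r : R) : R := (-1) ^+ (r < 0)%R / 3 ^+ n.+1.
pose S := fix S n : V -> R^o :=
  if n is m.+1 then fun y => S m y + k m (S m (x m)) *: (g m y : R^o)
  else fun=> 0.
have Sl n : linear (S n).
  elim: n => [|n IH] b y z /=; first by rewrite scaler0 addr0.
  by rewrite IH linearP !scalerDr !scalerA [k _ _ * b]mulrC addrACA.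
have Sp n y : `|S n.+1 y - S n y| <= p y / 3 ^+ n.+1.
  rewrite /= addrC addKr normrM /k normrM normr_sign mul1r mulrC.
  rewrite [`|_^-1|]gtr0_norm ?invr_gt0 ?exprn_gt0//.
  by rewrite ler_pM2r ?invr_gt0 ?exprn_gt0// (gP n).1.
have Sx n : p (x n) / 3 ^+ n.+1 <= `|S n.+1 (x n)|.
  have : 0 <= p (x n) / 3 ^+ n.+1 by rewrite divr_ge0 ?exprn_ge0// seminorm_ge0.
  rewrite /= (gP n).2 -[k _ _ *: _]/(k _ _ * _) /k mulrAC -mulrA.
  move: (p (x n) / _) (S n (x n)) => t r t0.
  have [r0|r0] := ltP r 0; rewrite ?expr1 ?expr0 ?mulN1r ?mul1r.
    by rewrite ler0_norm; lra.
  by rewrite ger0_norm; lra.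
have [|f] := linear_geometric_increments (q := 3) _ Sl Sp; first by lra.
rewrite (_ : 3 - 1 = 2)//; last by lra.
move=> fS; exists f; split=> [y|n].
  have := fS 0 y; rewrite subr0 expr0 divr1 => /le_trans; apply.
  by have := seminorm_ge0 y sp; lra.
have := lerB_dist (S n.+1 (x n)) (f (x n)); rewrite distrC.
by have := fS n.+1 (x n); have := Sx n; lra.
Qed.

Lemma bounded_of_dominated_functionals (A : set V) : seminorm p ->
  (forall f : {linear V -> R^o}, (forall x, `|f x| <= p x) ->
    exists c, forall x, A x -> `|f x| <= c) ->
  exists c, forall x, A x -> p x <= c.
Proof.
move=> sp pA; apply: contrapT => /forallNP unbounded.
have /choice[x xP] (n : nat) : exists x, A x /\ n%:R < p x / 3 ^+ n.+1 / 2.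
  have /existsNP[x /not_implyP[Ax /negP]] := unbounded (n%:R * 2 * 3 ^+ n.+1).
  rewrite -ltNge => px; exists x; split=> //.
  by rewrite !ltr_pdivlMr ?exprn_gt0.
have [f [fp fx]] := gliding_hump_functional x sp; have [c Ac] := pA f fp.
have [Ax px] := xP (Num.truncn c).+1.
have := Ac _ Ax; apply/negP; rewrite -ltNge.
exact: lt_trans (truncnS_gt c) (lt_le_trans px (fx _)).
Qed.

End uniform_boundedness.

Theorem weakly_bounded_bounded (R : realType) (E : tvsType R) (A : set E) :
  (forall l : {linear E -> R^o}, continuous l ->
    exists c, forall x, A x -> `|l x| <= c) ->
  lcs_bounded (lcs_of_tvs E) A.
Proof.
move=> wA; apply/lcs_bounded_seminormP => p cp.
apply: (bounded_of_dominated_functionals cp.1) => f fp; apply: wA.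
exact: dominated_linear_continuous cp fp.
Qed.

(** * Frechet derivatives of families of maps *)

Definition radially_open (R : realType) (V : lmodType R) (U : set V) :=
  forall x h, U x -> \forall t \near (0 : R), U (x + t *: h).

Lemma smooth_curve_line (R : realType) (E : tvsType R) (x h : E) :
  smooth_curve (fun t : R => x + t *: h).
Proof.
exists (fun n t => match n with 0 => x + t *: h | 1 => h | _ => 0 end) => //.
have near_cst (g : R -> E) (l : E) : (forall s : R, s != 0 -> g s = l) ->
    g s @[s --> (0 : R)^'] --> l.
  move=> gl; apply: (@cvg_trans _ (l @[s --> (0 : R)^'])); last exact: cvg_cst.
  by apply: near_eq_cvg; near=> s; rewrite gl//; near: s; exact: nbhs_dnbhs_neq.
move=> [|[|n]] t; apply: near_cst => s s0; rewrite ?subrr ?scaler0//.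
rewrite opprD addrACA subrr add0r -scalerBl addrAC subrr add0r.
by rewrite scalerA mulVf// scale1r.
Unshelve. all: by end_near. Qed.

Lemma cinfty_open_radially_open (R : realType) (E : tvsType R) (U : set E) :
  cinfty_open U -> radially_open U.
Proof.
move=> oU x h Ux; have := oU _ (smooth_curve_line x h).
by rewrite openE => /(_ 0) /=; rewrite scale0r addr0; exact.
Qed.

Definition arg_tail (T : Type) k (v : 'I_k.+1 -> T) : 'I_k -> T :=
  fun i => v (lift ord0 i).

Lemma padl1 (T : Type) k (v : 'I_k.+1 -> T) : padl 1 (v ord0) (arg_tail v) = v.
Proof.
apply/funext => i; rewrite /padl; case: (split_ordP i) => j ->.
  by congr v; apply/val_inj; rewrite /= (ord1 j).
by congr v; apply/val_inj.
Qed.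

Section frechet_derivatives.
Context {R : realType} {X F : normedModType R}.

Lemma lsym_eval_continuous_linear k (v : 'I_k -> X) :
  continuous_linear (fun l : Lsym k X F => l v).
Proof.
pose c := \prod_i `|v i|.
apply: (bounded_continuous_linear (c := c)) => // l /ltW l1.
by rewrite (le_trans (opnormP _ _))// ler_piMl// prodr_ge0.
Qed.

Variable U : set X.
Implicit Types (f : U -> F) (D : jet X F X).

Definition frechet_jet f : jet X F X := xget 0 (frechet_derivs f).

Lemma frechet_jetP f : frechet_smooth f -> frechet_derivs f (frechet_jet f).
Proof. by move=> [D fD]; exact: xgetPex (ex_intro _ D fD). Qed.

Lemma frechet_jet0 f (x : U) v : frechet_smooth f ->
  frechet_jet f 0 (val x) v = f x.
Proof. by move=> /frechet_jetP[]. Qed.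

Lemma frechet_smoothZ a f : frechet_smooth f -> frechet_smooth (a *: f).
Proof.
move=> [D [D0 dD]]; exists (a *: D); split=> [x v|k x Ux].
  by rewrite -[LHS]/(a *: D 0 (val x) v) D0.
have dDx := dD k x Ux; apply: is_diff_eq (is_diffZ a dDx) _.
by apply/funext => h; exact/val_inj.
Qed.

Lemma frechet_derivs_cvg f D k x (v : 'I_k.+1 -> X) :
  frechet_derivs f D -> U x ->
  n.+1%:R *: (D k (x + n.+1%:R^-1 *: v ord0) (arg_tail v) - D k x (arg_tail v))
    @[n --> \oo] --> D k.+1 x v.
Proof.
move=> [_ dD] Ux; have [dfx dE] := dD k x Ux.
pose plug h := lsym_plug 1 (D (1 + k)%N x) h.
have quotient_cvg : t^-1 *: (D k (t *: v ord0 + x) - D k x)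
    @[t --> (0 : R)^'] --> plug (v ord0).
  by rewrite -[plug]dE -deriveE//; exact: diff_derivable.
have inv_cvg : n.+1%:R^-1 @[n --> \oo] --> (0 : R)^'.
  move=> P /= P0; have := @cvg_harmonic R _ P0; apply: (@filterS _ \oo) => n.
  by apply; rewrite /harmonic /= invr_eq0 pnatr_eq0.
have := cvg_comp _ _ (cvg_comp _ _ inv_cvg quotient_cvg)
  ((lsym_eval_continuous_linear (arg_tail v)).2 _).
rewrite -[plug _ _]/(D k.+1 x (padl 1 (v ord0) (arg_tail v))) padl1.
apply: cvg_trans; apply: near_eq_cvg; near=> n.
by rewrite /= invrK [x + _]addrC.
Unshelve. all: by end_near. Qed.

Lemma frechet_jet_continuous_linear (V : completeNormedModType R)
    (S : V -> U -> F) : radially_open U -> (forall e, frechet_smooth (S e)) ->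
  (forall x : U, continuous_linear (fun e => S e x)) ->
  forall k x (v : 'I_k -> X), U x ->
    continuous_linear (fun e => frechet_jet (S e) k x v).
Proof.
move=> oU smoothS evS; elim=> [|k IH] x v Ux.
  pose Ux' : U := exist _ x (mem_set Ux).
  have -> : (fun e => frechet_jet (S e) 0 x v) = fun e => S e Ux'.
    by apply/funext => e; rewrite -(frechet_jet0 Ux' v (smoothS e)).
  exact: evS.
apply: continuous_linear_cvg => [|e]; last first.
  exact: frechet_derivs_cvg (frechet_jetP (smoothS e)) Ux.
have [N _ UN] := @cvg_harmonic R _ (oU x (v ord0) Ux).
exists N => // n /UN Un.
under eq_fun do rewrite scalerBr -scaleNr.
by apply: continuous_linear_lincomb; exact: IH.
Qed.

End frechet_derivatives.

(** * The norms of jets *)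

Lemma sup0_leP (R : realType) (A : set \bar R) (c : R) : 0 <= c ->
  (Defs.sup0 A <= c%:E)%E <-> forall a, A a -> (a <= c%:E)%E.
Proof.
move=> c0; split=> [Ac a Aa|Ac].
  by apply: le_trans Ac; apply: ereal_sup_ubound; right.
by apply: ge_ereal_sup => a [->|/Ac//]; rewrite lee_fin.
Qed.

Lemma lty_le_nat (R : realType) (x : \bar R) : (x < +oo)%E ->
  exists n : nat, (x <= n%:R%:E)%E.
Proof.
case: x => [r _|//|_]; last by exists 0; rewrite leNye.
by exists (Num.truncn r).+1; rewrite lee_fin ltW// truncnS_gt.
Qed.

Lemma opnorm_leP (R : realType) (X F : normedModType R) k (l : Lsym k X F)
    (c : R) :
  `|l| <= c <-> forall v, (forall i, `|v i| <= 1) -> `|l v| <= c.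
Proof.
split=> [lc v v1|lc]; first by apply: le_trans lc; exact: opnorm_ub.
apply: ge_sup; first exact: (opnorm_has_sup l).1.
by move=> _ [v v1 <-]; exact: lc.
Qed.

Section jet_norms.
Context {R : realType} {X F : normedModType R} (M : nat -> R) (K : set X).
Hypothesis wM : weight_sequence M.
Local Notation J := (jet X F K).
Implicit Types (g h : J) (rho a b c d : R).

Definition jet_weight rho m : R := m`!%:R * rho ^+ m * M m.

Lemma jet_weight_gt0 rho m : 0 < rho -> 0 < jet_weight rho m.
Proof.
move=> rho0; have [M0 _ _] := wM.
by rewrite !mulr_gt0 ?ltr0n ?fact_gt0 ?exprn_gt0.
Qed.

Lemma jet_weight_le rho rho' m : 0 < rho <= rho' ->
  jet_weight rho m <= jet_weight rho' m.
Proof.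
move=> /andP[rho0 rr']; have [M0 _ _] := wM.
have rho'0 := lt_le_trans rho0 rr'.
rewrite ler_pM2r// ler_pM2l ?ltr0n ?fact_gt0//.
by rewrite lerXn2r ?nnegrE ?(ltW rho0) ?(ltW rho'0).
Qed.

(* The linear maps of order m whose suprema make up the norms jnorm_rho. *)
Variant jet_test : nat -> (J -> F) -> Prop :=
| JetValue m (x : K) (v : 'I_m -> X) of (forall i, `|v i| <= 1) :
    jet_test m (fun g => g m x v)
| JetRemainder n k (x y : K) (v : 'I_k -> X) of
    x <> y & (forall i, `|v i| <= 1) :
    jet_test (n + k).+1
      (fun g => (n.+1`!%:R / `|val x - val y| ^+ n.+1) *: jrem g n k y x v).

Lemma jnorm_leP g m c : 0 <= c -> (jnorm g m <= c%:E)%E <->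
  forall (x : K) v, (forall i, `|v i| <= 1) -> `|g m x v| <= c.
Proof.
move=> c0; split=> [/(sup0_leP _ c0) gc x v|gc].
  have := gc _ (imageP _ (I : setT x)).
  by rewrite lee_fin => /opnorm_leP; exact.
apply/(sup0_leP _ c0) => _ [x _ <-]; rewrite lee_fin; apply/opnorm_leP.
exact: gc.
Qed.

Lemma jremnorm_leP g n k c : 0 <= c -> (jremnorm g n k <= c%:E)%E <->
  forall (x y : K) v, x <> y -> (forall i, `|v i| <= 1) ->
    `|(n.+1`!%:R / `|val x - val y| ^+ n.+1) *: jrem g n k y x v| <= c.
Proof.
move=> c0.
have factor_gt0 (x y : K) : x <> y ->
    0 < n.+1`!%:R / `|val x - val y| ^+ n.+1 :> R.
  move=> xy; rewrite divr_gt0 ?ltr0n ?fact_gt0// exprn_gt0// normr_gt0 subr_eq0.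
  by apply/eqP => /val_inj.
split=> [/(sup0_leP _ c0) gc x y v xy v1|gc].
  have := gc _ (imageP _ (xy : [set xy : K * K | xy.1 <> xy.2] (x, y))).
  rewrite lee_fin /= mulrAC -ler_pdivlMl ?factor_gt0// => /opnorm_leP/(_ v v1).
  by rewrite ler_pdivlMl ?factor_gt0// normrZ gtr0_norm ?factor_gt0.
apply/(sup0_leP _ c0) => _ [[x y] xy <-]; rewrite lee_fin /= mulrAC.
rewrite -ler_pdivlMl ?factor_gt0//; apply/opnorm_leP => v v1.
rewrite ler_pdivlMl ?factor_gt0//.
by have := gc x y v xy v1; rewrite normrZ gtr0_norm ?factor_gt0.
Qed.

Lemma jnorm_rho_leP rho c g : 0 < rho -> 0 <= c ->
  (jnorm_rho M rho g <= c%:E)%E <->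
  forall m psi, jet_test m psi -> `|psi g| <= c * jet_weight rho m.
Proof.
move=> rho0 c0; have w0 m := jet_weight_gt0 m rho0.
have cw0 m : 0 <= c * jet_weight rho m by rewrite mulr_ge0// ltW.
rewrite /jnorm_rho ge_max; split.
  move=> /andP[/(sup0_leP _ c0) valc /(sup0_leP _ c0) remc] _ _ [].
    move=> m x v v1; have := valc _ (imageP _ (I : setT m)).
    by rewrite lee_pdivrMr ?w0// -EFinM => /(jnorm_leP _ _ (cw0 m)); exact.
  move=> n k x y v xy v1; have := remc _ (imageP _ (I : setT (n, k))).
  rewrite /= lee_pdivrMr ?(w0 (n + k).+1)// -EFinM.
  by move=> /(jremnorm_leP _ _ _ (cw0 _)); exact.
move=> gc; apply/andP; split; apply/(sup0_leP _ c0).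
  move=> _ [m _ <-]; rewrite lee_pdivrMr ?w0// -EFinM.
  by apply/(jnorm_leP _ _ (cw0 m)) => x v v1; exact: (gc _ _ (JetValue x v1)).
move=> _ [[n k] _ <-]; rewrite /= lee_pdivrMr ?(w0 (n + k).+1)// -EFinM.
apply/(jremnorm_leP _ _ _ (cw0 _)) => x y v xy v1.
exact: (gc _ _ (JetRemainder n xy v1)).
Qed.

Lemma jrem_eval g n k (x y : K) v : jrem g n k y x v =
  g k x v -
  \sum_(j < n.+1) j`!%:R^-1 *: g (j + k)%N y (padl j (val x - val y) v).
Proof.
have sum_eval m (l : 'I_m -> Lsym k X F) : (\sum_i l i) v = \sum_i l i v.
  by elim/big_rec2 : _ => // i a b _ <-.
have -> : jrem g n k y x v = g k x v - (\sum_(j < n.+1) j`!%:R^-1 *: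
  lsym_plug j (g (j + k)%N y) (val x - val y)) v by [].
by rewrite sum_eval.
Qed.

Lemma jet_test_lincomb_ind (Q : (J -> F) -> Prop) :
  (forall k x v, Q (fun g => g k x v)) ->
  (forall a b phi psi, Q phi -> Q psi ->
    Q (fun g => a *: phi g + b *: psi g)) ->
  forall m psi, jet_test m psi -> Q psi.
Proof.
move=> Qev Qlin m psi [{}m x v _|n k x y v _ _]; first exact: Qev.
have QZ a phi : Q phi -> Q (fun g => a *: phi g).
  move=> Qphi; have := Qlin a 0 _ _ Qphi Qphi.
  by under eq_fun do rewrite scale0r addr0.
have Q0 : Q (fun=> 0).
  by have := QZ 0 _ (Qev k x v); under eq_fun do rewrite scale0r.
have Qsum : Q (fun g => \sum_(j < n.+1)
    j`!%:R^-1 *: g (j + k)%N y (padl j (val x - val y) v)).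
  elim: (index_enum _) => [|j s IH]; first by under eq_fun do rewrite big_nil.
  by under eq_fun do rewrite big_cons -[X in _ + X]scale1r; exact: Qlin.
apply: QZ; under eq_fun do rewrite jrem_eval -[g in g - _]scale1r -scaleN1r.
exact: Qlin.
Qed.

Lemma jet_test_linear m psi : jet_test m psi -> linear psi.
Proof.
apply: (@jet_test_lincomb_ind (fun psi => linear psi)) => // a b phi {}psi.
move=> lphi lpsi c g h; rewrite lphi lpsi !scalerDr addrACA.
by rewrite !scalerA ![_ * c]mulrC.
Qed.

Lemma jet_test_continuous_linear (V : normedModType R) (S : V -> J) m psi :
  (forall k x v, continuous_linear (fun e => S e k x v)) ->
  jet_test m psi -> continuous_linear (fun e => psi (S e)).
Proof.
move=> evS; apply: (@jet_test_lincomb_ind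
  (fun psi => continuous_linear (fun e => psi (S e)))) => // a b phi {}psi.
exact: continuous_linear_lincomb.
Qed.

Lemma jnorm_rho_lincomb_le rho a b c d g h : 0 < rho -> 0 <= c -> 0 <= d ->
  (jnorm_rho M rho g <= c%:E)%E -> (jnorm_rho M rho h <= d%:E)%E ->
  (jnorm_rho M rho (a *: g + b *: h)%R <= (`|a| * c + `|b| * d)%:E)%E.
Proof.
move=> rho0 c0 d0 /(jnorm_rho_leP _ rho0 c0) gc /(jnorm_rho_leP _ rho0 d0) hd.
apply/jnorm_rho_leP => // [|m psi psim]; first by rewrite addr_ge0// mulr_ge0.
pose l := pack_linear (jet_test_linear psim).
rewrite -[psi _]/(l _) linearD !linearZ /= (le_trans (ler_normD _ _))// !normrZ.
rewrite mulrDl -!mulrA lerD// ler_wpM2l//; [exact: gc|exact: hd].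
Qed.

Lemma jnorm_rho_ge0 rho g : (0 <= jnorm_rho M rho g)%E.
Proof. by rewrite le_max ereal_sup_ubound//; left. Qed.

Lemma jnorm_rho0 rho : 0 < rho -> jnorm_rho M rho (0%R : J) = 0%E.
Proof.
move=> rho0; apply/eqP; rewrite eq_le jnorm_rho_ge0 andbT.
apply/jnorm_rho_leP => // m psi /jet_test_linear lpsi.
have -> : psi 0 = 0 by exact: linear0 (pack_linear lpsi).
by rewrite normr0 mul0r.
Qed.

Lemma jnorm_rho_nonincreasing rho rho' g : 0 < rho <= rho' ->
  (jnorm_rho M rho' g <= jnorm_rho M rho g)%E.
Proof.
move=> rr'; have /andP[rho0 /(lt_le_trans rho0) rho'0] := rr'.
have := jnorm_rho_ge0 rho g; case E : (jnorm_rho M rho g) => [c| |]// c0.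
  have /(jnorm_rho_leP _ rho0 c0) gc : (jnorm_rho M rho g <= c%:E)%E.
    by rewrite E.
  apply/(jnorm_rho_leP _ rho'0 c0) => m psi /gc /le_trans; apply.
  by rewrite ler_wpM2l// jet_weight_le.
by rewrite leey.
Qed.

Lemma CM_rho_carrier_subspace rho : 0 < rho ->
  subspace (lcs_carrier (CM_rho M K rho : lcs J)).
Proof.
move=> rho0; split.
  split; last by rewrite jnorm_rho0.
  by move=> k; exact: (@cst_continuous _ _ (0 : Lsym k X F)).
move=> a g h [gc /lty_le_nat[n gn]] [hc /lty_le_nat[m hm]]; split=> [k y|].
  have ag : a *: g k z @[z --> y] --> a *: g k y by exact: cvgZl_tmp (gc k y).
  exact: cvgD ag (hc k y).
have := jnorm_rho_lincomb_le a 1 rho0 (ler0n R n) (ler0n R m) gn hm.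
by rewrite scale1r => /le_lt_trans; apply; exact: ltry.
Qed.

Lemma CM_rho_carrier_mono rho rho' : 0 < rho <= rho' ->
  lcs_carrier (CM_rho M K rho : lcs J) `<=` lcs_carrier (CM_rho M K rho').
Proof.
move=> rr' g [gc gfin]; split=> //.
exact: le_lt_trans (jnorm_rho_nonincreasing g rr') gfin.
Qed.

Lemma CM_compact_carrier_subspace (t : flavour) :
  subspace (lcs_carrier (CM_compact M K t : lcs J)).
Proof.
case: t => /=.
  split; first by split=> // rho rho0; exact: (CM_rho_carrier_subspace rho0).1.
  move=> a g h [_ gC] [_ hC]; split=> // rho rho0.
  by apply: (CM_rho_carrier_subspace rho0).2; [exact: gC|exact: hC].
rewrite -(bigcup_image _ (fun rho => lcs_carrier (CM_rho M K rho : lcs J)) id).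
apply: subspace_bigcup.
- by exists (lcs_carrier (CM_rho M K 1 : lcs J)), 1 => //=.
- move=> _ _ [rho rho0 <-] [rho' rho'0 <-]; have [rr'|/ltW r'r] := leP rho rho'.
    by left; apply: CM_rho_carrier_mono; rewrite rr' andbT.
  by right; apply: CM_rho_carrier_mono; rewrite r'r andbT.
- by move=> _ [rho rho0 <-]; exact: CM_rho_carrier_subspace.
Qed.

Lemma CM_compact_continuous (t : flavour) g k :
  lcs_carrier (CM_compact M K t) g -> continuous (g k).
Proof. by case: t => [[_ /(_ 1 ltr01)[]]|[rho _ []]]. Qed.

End jet_norms.

(** * Continuity of maps into spaces of ultradifferentiable maps *)

Lemma cvg_lcs_initial (R : realType) (V : lmodType R) (C : set V) (I : Type)
    (D : set I) (W : I -> lmodType R) (f : forall i, V -> W i)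
    (Y : forall i, lcs (W i)) (Z : Type) (G : set_system Z) (S : Z -> V) :
  Filter G -> (forall i, D i -> f i (S z) @[z --> G] --> lcs_nbhs0 (Y i)) ->
  S @ G --> lcs_nbhs0 (lcs_initial C D f Y).
Proof.
move=> FG SY N; apply; split; first exact: fmap_filter.
by move=> _ [i Di [P YP <-]]; exact: SY YP.
Qed.

Section families_of_jets.
Context {R : realType} {X F : normedModType R} (M : nat -> R) (K : set X).
Hypothesis wM : weight_sequence M.
Context {V : completeNormedModType R} (S : V -> jet X F K).
Hypothesis evS : forall k x (v : 'I_k -> X),
  continuous_linear (fun e => S e k x v).

Lemma jnorm_rho_family_sublevel rho c : 0 < rho -> 0 <= c ->
  [set e | (jnorm_rho M rho (S e) <= c%:E)%E] =
  \bigcap_(t in [set t | jet_test t.1 t.2])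
    [set e | `|t.2 (S e)| <= c * jet_weight M rho t.1].
Proof.
move=> rho0 c0; apply/seteqP; split=> e.
  by move=> /(jnorm_rho_leP wM _ rho0 c0) Sec [m psi]; exact: Sec.
move=> Sec; apply/(jnorm_rho_leP wM _ rho0 c0) => m psi.
exact: (Sec (m, psi)).
Qed.

Lemma jnorm_rho_family_locally_bounded (rho : nat -> R) :
  (forall n, 0 < rho n) ->
  (forall e, exists n, (jnorm_rho M (rho n) (S e) <= n%:R%:E)%E) ->
  exists n, \forall e \near 0, (jnorm_rho M (rho n) (S e) <= n%:R%:E)%E.
Proof.
move=> rho0.
pose sublevel n := [set e | (jnorm_rho M (rho n) (S e) <= n%:R%:E)%E].
apply: (@baire_absconvex _ V sublevel) => n.
  rewrite /sublevel jnorm_rho_family_sublevel//.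
  apply: closed_bigI => -[m psi] /= psim.
  apply: (@preimage_closed _ _ (fun e => `|psi (S e)|) [set r | r <= _]).
    move=> e _; apply: cvg_norm.
    exact: (jet_test_continuous_linear evS psim).2.
  exact: closed_le.
rewrite /sublevel jnorm_rho_family_sublevel//.
apply: absconvex_bigcap => -[m psi] /= psim; apply: seminorm_absconvex.
  exact/norm_linear_seminorm/(jet_test_continuous_linear evS psim).1.
by rewrite mulr_ge0// ltW// jet_weight_gt0.
Qed.

Lemma cvg0_CM_rho rho c : 0 < rho -> 0 <= c ->
  (forall e k, continuous (S e k)) ->
  (\forall e \near 0, (jnorm_rho M rho (S e) <= c%:E)%E) ->
  S e @[e --> (0 : V)] --> lcs_nbhs0 (CM_rho M K rho).
Proof.
move=> rho0 c0 Sc S0 N [e e0 eN].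
pose d := e / 2 / (c + 1); have d0 : 0 < d by rewrite !divr_gt0// ltr_wpDl.
apply: filterS (nbhs0Z (lt0r_neq0 d0) S0) => _ [x xc <-]; apply: eN.
have small : (jnorm_rho M rho (S (d *: x)) <= (e / 2)%:E)%E.
  have e20 : 0 <= e / 2 by rewrite divr_ge0// ltW.
  apply/(jnorm_rho_leP wM _ rho0 e20) => m psi psim.
  have [/norm_linear_seminorm[_ ->] _] := jet_test_continuous_linear evS psim.
  move: xc => /(jnorm_rho_leP wM _ rho0 c0)/(_ _ _ psim) xc.
  rewrite gtr0_norm// (le_trans (ler_wpM2l (ltW d0) xc))// mulrA.
  rewrite ler_pM2r ?jet_weight_gt0// -mulrA ler_piMr// mulrC.
  by rewrite ler_pdivrMr ?ltr_wpDl// mul1r lerDl.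
split; last by apply: le_lt_trans small _; rewrite lte_fin; lra.
by split; [exact: Sc|exact: le_lt_trans small (ltry _)].
Qed.

Lemma cvg0_CM_compact (t : flavour) :
  (forall e, lcs_carrier (CM_compact M K t) (S e)) ->
  S e @[e --> (0 : V)] --> lcs_nbhs0 (CM_compact M K t).
Proof.
move=> SC.
have Sc e k : continuous (S e k) by exact: CM_compact_continuous (SC e).
case: t SC => SC /=.
  apply: (@cvg_lcs_initial R (jet X F K) setT R [set rho | 0 < rho]
    (fun=> jet X F K) (fun=> id) (CM_rho M K)) => rho rho0.
  have [e|n Sn] := @jnorm_rho_family_locally_bounded (fun=> rho) (fun=> rho0).
    by have [_ /(_ rho rho0)[_ /lty_le_nat]] := SC e.
  exact: cvg0_CM_rho Sn.
have n0 n : 0 < n.+1%:R :> R by [].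
have [e|n Sn] := jnorm_rho_family_locally_bounded n0; last first.
  move=> N [A [_ _ /(_ _ (n0 n)) Anbhs AN]]; apply: filterS AN _.
  exact: cvg0_CM_rho Sn _ Anbhs.
have [rho rho0 [_ /lty_le_nat[m Sm]]] := SC e.
pose n := maxn m (Num.truncn rho); exists n.
apply: (@le_trans _ _ m%:R%:E); last by rewrite lee_fin ler_nat leq_maxl.
apply: le_trans Sm; apply: jnorm_rho_nonincreasing => //; rewrite rho0/=.
by rewrite (le_trans (ltW (truncnS_gt rho)))// ler_nat ltnS leq_maxr.
Qed.

End families_of_jets.

Lemma cvg0_CM_open (R : realType) (X F : normedModType R) (M : nat -> R)
    (U : set X) (t : flavour) (V : completeNormedModType R) (S : V -> U -> F) :
  weight_sequence M -> radially_open U ->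
  (forall e, lcs_carrier (CM_open M U t) (S e)) ->
  (forall x : U, continuous_linear (fun e => S e x)) ->
  S e @[e --> (0 : V)] --> lcs_nbhs0 (CM_open M U t).
Proof.
move=> wM oU SC evS; apply: cvg_lcs_initial => K KU.
apply: cvg0_CM_compact => // [k x v|e]; last exact: (SC e).2.
apply: (frechet_jet_continuous_linear oU (fun e => (SC e).1) evS).
by case: KU => _ _; apply; exact: set_mem (valP x).
Qed.

Lemma trace_radially_open (R : realType) (F : convenientType R) (U : set F)
    (D : bdisk F) :
  radially_open U -> radially_open (@trace _ _ U D).
Proof. by move=> oU x h; exact: oU. Qed.

Lemma cvg0_CM (R : realType) (F G : convenientType R) (M : nat -> R)
    (U : set F) (t : flavour) (V : completeNormedModType R) (S : V -> U -> G) :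
  weight_sequence M -> cinfty_open U ->
  (forall e, lcs_carrier (CM G M t U) (S e)) ->
  (forall (x : U) (l : {linear G -> R^o}), continuous l ->
    continuous_linear (fun e => l (S e x) : R^o)) ->
  S e @[e --> (0 : V)] --> lcs_nbhs0 (CM G M t U).
Proof.
move=> wM oU SC evS; apply: cvg_lcs_initial => -[l D] /= lc.
apply: cvg0_CM_open => // [|e|x].
- exact/trace_radially_open/cinfty_open_radially_open.
- exact: (SC e).2 (l, D) lc.
- exact: evS.
Qed.

(** * Boundedness of evaluations *)

Section jet_evaluation.
Context {R : realType} {X F : normedModType R} (M : nat -> R) (t : flavour).
Hypothesis wM : weight_sequence M.

Lemma CM_compact_ev_nbhs0 (K : set X) (x : K) (v : 'I_0 -> X) :
  lcs_nbhs0 (CM_compact M K t) [set g : jet X F K | `|g 0 x v| <= 1].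
Proof.
pose N : set (jet X F K) := [set g : jet X F K | `|g 0 x v| <= 1].
have rho_nbhs rho (A : set (jet X F K)) : 0 < rho ->
    lcs_carrier (CM_rho M K rho) `&` N `<=` A -> lcs_nbhs0 (CM_rho M K rho) A.
  move=> rho0 NA; exists 1 => // g [gX /ltW/(jnorm_rho_leP wM _ rho0 ler01) g1].
  apply: NA; split=> //; have v1 i : `|v i| <= 1 by case: i.
  have := g1 _ _ (JetValue x v1); have [_ M0 _] := wM.
  by rewrite /jet_weight expr0 M0 !mulr1.
case: t => /=.
  move=> Q [_]; apply; exists 1; first exact: ltr01.
  by exists N => //; apply: rho_nbhs => // g [].
exists (lcs_carrier (CM_compact M K Roumieu) `&` N).
split=> [|g []//|rho rho0|g []//]; last first.
  by apply: rho_nbhs => // g [gX gN]; split=> //; exists rho.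
apply: subspaceI_absconvex; first exact: CM_compact_carrier_subspace.
by apply: seminorm_absconvex => //; exact: norm_linear_seminorm.
Qed.

Lemma CM_open_ev_nbhs0 (U : set X) (x : U) :
  exists2 N, lcs_nbhs0 (CM_open M U t) N &
    forall f : U -> F, frechet_smooth f -> N f -> `|f x| <= 1.
Proof.
pose K := [set val x]; pose xK : K := exist _ (val x) (mem_set erefl).
pose v (i : 'I_0) : X := 0.
exists [set f | `|frechet_jet f 0 (val x) v| <= 1]; last first.
  by move=> f /(frechet_jet0 x v) <-.
move=> Q [_]; apply; exists K.
  split; first exact: compact_set1.
    by move=> y z s /set_mem -> /set_mem ->; apply/mem_set; rewrite convmm.
  by move=> _ ->; exact: set_mem (valP x).
exists [set g : jet X F K | `|g 0 xK v| <= 1] => //.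
exact: CM_compact_ev_nbhs0.
Qed.

End jet_evaluation.

Lemma CM_ev_bounded (R : realType) (F G : convenientType R) (M : nat -> R)
    (U : set F) (t : flavour) (A : set (U -> G)) (x : U)
    (l : {linear G -> R^o}) :
  weight_sequence M -> lcs_bounded (CM G M t U) A -> continuous l ->
  exists c, forall f, A f -> `|l (f x)| <= c.
Proof.
move=> wM [AC bA] lc; pose D := hull_bdisk (bounded_set1 (val x)).
have Dx : bdisk_set D (val x) by exact: sub_gen_smallest.
pose x' : @trace _ _ U D :=
  exist _ (MkEB (bdisk_sub_EB Dx)) (mem_set (set_mem (valP x) : U (val x))).
have x'E : trace_incl x' = x by exact/val_inj.
pose restr (f : U -> G) (y : @trace _ _ U D) : R^o := l (f (trace_incl y)).
have [N Nnbhs N1] := @CM_open_ev_nbhs0 _ _ R^o M t wM _ x'.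
have [|r r0 Ar] := bA (restr @^-1` N).
  by move=> Q [_]; apply; exists (l, D) => //; exists N.
exists r => f Af; have [h Nh hf] := Ar f Af.
have restrE : restr h = r^-1 *: restr f.
  apply/funext => y; rewrite -[RHS]/(r^-1 *: restr f y) -hf /restr -linearZ.
  by rewrite -[(r *: h) _]/(r *: h _) scalerA mulVf ?gt_eqF// scale1r.
have smooth_h : frechet_smooth (restr h).
  by rewrite restrE; apply: frechet_smoothZ; exact: ((AC f Af).2 (l, D) lc).1.
have := N1 _ smooth_h Nh; rewrite restrE -[(_ *: _) _]/(r^-1 *: restr f x').
by rewrite normrZ gtr0_norm ?invr_gt0// ler_pdivrMl// mulr1 /restr x'E.
Qed.

Theorem theorem6p1 (R : realType) (M : nat -> R) (wM : weight_sequence M)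
    (b : flavour) (E F G : convenientType R) (U : set F) (oU : cinfty_open U)
    (T : {linear E -> (U -> G)})
    (TU : forall e : E, lcs_carrier (CM G M b U) (T e)) :
  bounded_map (lcs_of_tvs E) (CM G M b U) T <->
  forall x : U, bounded_map (lcs_of_tvs E) (lcs_of_tvs G) (fun e => T e x).
Proof.
split=> [bT x A bA|evT].
  apply: weakly_bounded_bounded => l lc.
  have [c Ac] := CM_ev_bounded x wM (bT A bA) lc.
  by exists c => _ [a Aa <-]; apply: Ac; exists a.
apply: bounded_map_bdisk => // B; apply: cvg0_CM => // x l lc.
have /lcs_bounded_seminormP/(_ _ (normr_continuous_seminorm lc))[c Bc] :=
  evT x _ (@bdisk_bounded _ _ B).
apply: (EB_continuous_linear (f := fun e => l (T e x) : R^o) (c := c)).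
  by move=> a e e'; rewrite linearP -[(_ + _) x]/(a *: T e x + T e' x) linearP.
by move=> e Be; apply: Bc; exists e.
Qed.
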